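(* Let $n\ge 4$ and $q\ge 2$ be integers, and let $(r_1,\ldots,r_n),(c_1,\ldots,c_n)\in(\mathbb{Z}/q\mathbb{Z})^n$ satisfy $\sum_{i=1}^n r_i=\sum_{j=1}^n c_j$. Consider the Diaconis--Gangolli walk on the set $\Omega$ of $n\times n$ contingency tables with entries in $\mathbb{Z}/q\mathbb{Z}$, row sums $(r_1,\ldots,r_n)$ and column sums $(c_1,\ldots,c_n)$, and let $d(t)$ denote its worst-case total variation distance from the uniform measure on $\Omega$ after $t$ steps ($t$ a nonnegative integer). Then: (a) (Upper bound) For every real $c\ge \frac{640}{\log\log(16n)}$, if $$t\ge \frac{n^2}{4\left(1-\cos\frac{2\pi}{q}\right)}\log n+\frac{n^2}{1-\cos\frac{2\pi}{q}}\,c\,\log\log(16n)\,\sqrt{\log n}\,\log q,$$ then $d(t)\le q^{-c}$. (b) (Lower bound) For every real $c\ge 0$, if $$t\le \frac{n^2}{4\left(1-\cos\frac{2\pi}{q}\right)}\log n-\frac{n^2}{4\left(1-\cos\frac{2\pi}{q}\right)}(c+12)\log q,$$ then $d(t)\ge 1-q^{-c}$.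
   Context: A contingency table over $\mathbb{Z}/q\mathbb{Z}$ is an $n\times n$ matrix with entries in $\mathbb{Z}/q\mathbb{Z}$, with prescribed row sums $(r_1,\dots,r_n)$ and column sums $(c_1,\dots,c_n)$ in $(\mathbb{Z}/q\mathbb{Z})^n$; $\Omega$ is the set of all of them. The Diaconis--Gangolli walk on $\Omega$: at each step, independently of the past, pick uniformly at random a pair of distinct rows and a pair of distinct columns, and flip a fair coin. If heads, add $T=\begin{pmatrix}-1&1\\1&-1\end{pmatrix}$ to the $2\times2$ submatrix formed by the chosen rows and columns; if tails, add $-T$ to it (arithmetic in $\mathbb{Z}/q\mathbb{Z}$). For $A,B\in\Omega$, $P^t_A(B)$ is the probability that the walk started at $A$ is at $B$ after $t$ steps, $\pi$ is the uniform probability measure on $\Omega$, and $$d(t)=\max_{A\in\Omega}\|P_A^t-\pi\|_{T.V.}=\max_{A\in\Omega}\frac12\sum_{B\in\Omega}|P^t_A(B)-\pi(B)|.$$ $\log$ is the natural logarithm. *)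

(* Defs.v *)
From HB Require Import structures.
From mathcomp Require Import all_boot all_order all_algebra.
From mathcomp Require Import reals exp trigo.

Set Implicit Arguments.
Unset Strict Implicit.
Unset Printing Implicit Defensive.

Import Order.TTheory GRing.Theory Num.Theory.
Local Open Scope ring_scope.

(* 'Z_q is the ring Z/qZ only for q >= 2; the theorem assumes 1 < q. *)
Definition tables (n q : nat) (r s : 'I_n -> 'Z_q) : {set 'M['Z_q]_n} :=
  [set A : 'M['Z_q]_n | [forall i, \sum_j A i j == r i]
                     && [forall j, \sum_i A i j == s j]].

(* Unordered pairs of distinct indices, listed increasingly. *)
Definition pairs (n : nat) : {set 'I_n * 'I_n} :=
  [set p : 'I_n * 'I_n | (p.1 < p.2)%N].

(* Row pair, column pair, and the coin (true for heads). *)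
Definition moves (n : nat) : {set ('I_n * 'I_n) * ('I_n * 'I_n) * bool} :=
  setX (setX (pairs n) (pairs n)) [set: bool].

(* The matrix with T = [-1, 1; 1, -1] on the chosen rows and columns and 0
   elsewhere. *)
Definition Tmx (n q : nat) (i j : 'I_n * 'I_n) : 'M['Z_q]_n :=
  - delta_mx i.1 j.1 + delta_mx i.1 j.2 + delta_mx i.2 j.1
  - delta_mx i.2 j.2.

Definition apply_move (n q : nat) (A : 'M['Z_q]_n)
    (m : ('I_n * 'I_n) * ('I_n * 'I_n) * bool) : 'M['Z_q]_n :=
  if m.2 then A + Tmx q m.1.1 m.1.2 else A - Tmx q m.1.1 m.1.2.

Definition step_prob (R : realType) (n q : nat) (A B : 'M['Z_q]_n) : R :=
  #|[set m in moves n | apply_move A m == B]|%:R / #|moves n|%:R.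

(* The sum ranges over all matrices; started in [tables r s], the walk stays
   there by [apply_move_tables] below. *)
Fixpoint walk_prob (R : realType) (n q t : nat) (A B : 'M['Z_q]_n) : R :=
  if t is t'.+1 then
    \sum_(C : 'M['Z_q]_n) walk_prob R t' A C * step_prob R C B
  else (A == B)%:R.

Definition unif_prob (R : realType) (n q : nat) (r s : 'I_n -> 'Z_q)
    (B : 'M['Z_q]_n) : R :=
  (B \in tables r s)%:R / #|tables r s|%:R.

Definition tv_dist (R : realType) (T : finType) (X : {set T})
    (mu nu : T -> R) : R :=
  2^-1 * \sum_(x in X) `|mu x - nu x|.

(* The default value 0 does not affect the maximum: distances are nonnegative,
   and [tables r s] is nonempty when the two margins have the same total. *)
Definition max_tv (R : realType) (n q : nat) (r s : 'I_n -> 'Z_q)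
    (t : nat) : R :=
  \big[Num.max/0]_(A in tables r s)
    tv_dist (tables r s) (walk_prob R t A) (unif_prob R r s).

Lemma apply_move_tables (n q : nat) (r s : 'I_n -> 'Z_q) (A : 'M['Z_q]_n)
    (m : ('I_n * 'I_n) * ('I_n * 'I_n) * bool) :
  A \in tables r s -> apply_move A m \in tables r s.
Proof.
have dr (i i' j : 'I_n) : \sum_k (delta_mx i j : 'M['Z_q]_n) i' k = (i' == i)%:R.
  rewrite (bigD1 j) //= big1 ?addr0 => [|k /negPf kj].
    by rewrite mxE eqxx andbT.
  by rewrite mxE kj andbF.
have dc (i j j' : 'I_n) : \sum_k (delta_mx i j : 'M['Z_q]_n) k j' = (j' == j)%:R.
  rewrite (bigD1 i) //= big1 ?addr0 => [|k /negPf ki].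
    by rewrite mxE eqxx.
  by rewrite mxE ki.
have sumE (i j : 'I_n * 'I_n) (x y : 'I_n) : (Tmx q i j : 'M_n) x y =
    - (delta_mx i.1 j.1 : 'M_n) x y + (delta_mx i.1 j.2 : 'M_n) x y
    + (delta_mx i.2 j.1 : 'M_n) x y - (delta_mx i.2 j.2 : 'M_n) x y.
  by rewrite /Tmx !mxE.
have Tr i j i' : \sum_k (Tmx q i j : 'M_n) i' k = 0.
  under eq_bigr do rewrite sumE.
  by rewrite !big_split /= !sumrN !dr addNr add0r subrr.
have Tc i j j' : \sum_k (Tmx q i j : 'M_n) k j' = 0.
  under eq_bigr do rewrite sumE.
  by rewrite !big_split /= !sumrN !dc addrAC addrK addNr.
have mE x y : (apply_move A m) x y = A x y
    + (if m.2 then (Tmx q m.1.1 m.1.2 : 'M_n) x y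
       else - (Tmx q m.1.1 m.1.2 : 'M_n) x y).
  by rewrite /apply_move; case: ifP => _; rewrite [LHS]mxE // [X in _ + X]mxE.
rewrite !inE => /andP[/forallP Ar /forallP Ac].
apply/andP; split; apply/forallP => i.
- rewrite -(eqP (Ar i)); under eq_bigr do rewrite mE.
  rewrite big_split /=.
  by case: (m.2); rewrite ?sumrN Tr ?oppr0 addr0.
- rewrite -(eqP (Ac i)); under eq_bigr do rewrite mE.
  rewrite big_split /=.
  by case: (m.2); rewrite ?sumrN Tc ?oppr0 addr0.
Qed.

(* Main.v *)
Require Import Defs.
From HB Require Import structures.
From mathcomp Require Import all_boot all_order all_algebra.
From mathcomp Require Import ring lra.
From mathcomp Require Import reals sequences exp trigo.

(* Everything is done with real cosines. For a matrix [Y] over Z/q, the function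
   [A |-> cos (2 pi <Y, A> / q + phi)] is an eigenfunction of the walk, with an
   eigenvalue [eigval Y] such that [1 - eigval Y] is the average of
   [1 - cos (2 pi D / q)], [D] being the alternating sum of [Y] over the four
   corners of a random pair of rows and columns.

   Upper bound. By Cauchy-Schwarz, [(2 d(t)) ^ 2] is at most the sum of
   [eigval Y ^ (2 t)] over the nonzero [Y] whose row [i0] and column [i0] vanish.
   Adding row and column constants to [Y], one reaches some [Z] whose number [k] of
   nonzero entries is at most n ^ 2 times the probability of [D <> 0]. Let
   s = sqrt (log n), and call an entry light if its row and its column have at most
   n / s nonzero entries. For k <= n ^ 2 / s, almost all quadruples through a light
   nonzero entry have no other nonzero corner, so that [l] light entries contribute
   a factor n ^ (- 2 l), which pays for choosing their positions, up to an error
   exp (O(s k)). The second term of [t] gives a factor q ^ (- C s k), which absorbs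
   this error, the choice of the values, and the heavy rows and columns: there are
   only q ^ n ways to fill such a line, and s k is at least n / 2 times their number.
   For k > n ^ 2 / s that factor alone beats the number q ^ (n ^ 2) of matrices.

   Lower bound. The sum [f] of [exp (2 i pi x / q)] over the entries [x] of [B - A]
   has mean 0 under the uniform law and a mean much larger than its standard
   deviation under the law of the walk. *)

Set Implicit Arguments.
Unset Strict Implicit.
Unset Printing Implicit Defensive.

Import Order.TTheory GRing.Theory Num.Theory.
Local Open Scope ring_scope.

(** * Cosines and sines on Z/q *)

Section Characters.
Variables (R : realType) (q : nat).
Hypothesis q_gt1 : (1 < q)%N.

Definition cosq (x : 'Z_q) : R := cos (2 * pi * (x : nat)%:R / q%:R).
Definition sinq (x : 'Z_q) : R := sin (2 * pi * (x : nat)%:R / q%:R).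
Definition gap : R := 1 - cos (2 * pi / q%:R).

Let q_neq0 : q%:R != 0 :> R.
Proof. by rewrite pnatr_eq0 -lt0n (ltn_trans _ q_gt1). Qed.

Lemma turn_nat (k : nat) :
  2 * pi * k%:R / q%:R =
  2 * pi * (k %% q)%:R / q%:R + (pi *+ 2) *+ (k %/ q) :> R.
Proof.
rewrite {1}(divn_eq k q) natrD natrM -[_ *+ (k %/ q)]mulr_natr -[pi *+ 2]mulr_natr.
by field.
Qed.

Lemma cosq_nat (k : nat) : cosq k%:R = cos (2 * pi * k%:R / q%:R).
Proof. by rewrite turn_nat (periodicn (@cosD2pi R)) /cosq val_Zp_nat. Qed.

Lemma sinq_nat (k : nat) : sinq k%:R = sin (2 * pi * k%:R / q%:R).
Proof. by rewrite turn_nat (periodicn (@sinD2pi R)) /sinq val_Zp_nat. Qed.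

Lemma cosqD x y : cosq (x + y) = cosq x * cosq y - sinq x * sinq y.
Proof.
rewrite -[in LHS](natr_Zp x) -[in LHS](natr_Zp y) -natrD cosq_nat.
by rewrite natrD mulrDr mulrDl cosD.
Qed.

Lemma sinqD x y : sinq (x + y) = sinq x * cosq y + cosq x * sinq y.
Proof.
rewrite -[in LHS](natr_Zp x) -[in LHS](natr_Zp y) -natrD sinq_nat.
by rewrite natrD mulrDr mulrDl sinD.
Qed.

Lemma cosq2Dsinq2 x : cosq x ^+ 2 + sinq x ^+ 2 = 1.
Proof. exact: cos2Dsin2. Qed.

Lemma cosq0 : cosq 0 = 1.
Proof. by rewrite /cosq mulr0 mul0r cos0. Qed.

Lemma sinq0 : sinq 0 = 0.
Proof. by rewrite /sinq mulr0 mul0r sin0. Qed.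

(** The natural number representing [- x] is not the opposite of the one representing [x], so parity
    of the real cosine does not apply directly. The addition formulas for [x + (- x) = 0] and
    Pythagoras determine [cosq (- x)] algebraically. *)
Lemma cosqN x : cosq (- x) = cosq x.
Proof.
have := cosq2Dsinq2 x; have := cosqD x (- x); have := sinqD x (- x).
rewrite subrr cosq0 sinq0.
set c := cosq x; set s := sinq x; set c' := cosq _; set s' := sinq _ => h0 h1 h2.
have : c' - c = c * (c * c' - s * s' - 1) + s * (s * c' + c * s')
  - c' * (c ^+ 2 + s ^+ 2 - 1) by ring.
by rewrite -h0 -h1 h2 !subrr !mulr0 !addr0 subr0 => /subr0_eq.
Qed.

Lemma sinqN x : sinq (- x) = - sinq x.
Proof.
have := cosq2Dsinq2 x; have := cosqD x (- x); have := sinqD x (- x).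
rewrite subrr cosq0 sinq0 cosqN.
set c := cosq x; set s := sinq x; set s' := sinq _ => h0 h1 h2.
have : s' - - s = c * (s * c + c * s') - s * (c * c - s * s' - 1)
  - s' * (c ^+ 2 + s ^+ 2 - 1) by ring.
by rewrite -h0 -h1 h2 !subrr !mulr0 !subr0 => /subr0_eq.
Qed.

Lemma cosqB x y : cosq (x - y) = cosq x * cosq y + sinq x * sinq y.
Proof. by rewrite cosqD cosqN sinqN mulrN opprK. Qed.

Lemma cosq_le1 x : cosq x <= 1. Proof. exact: cos_le1. Qed.
Lemma cosq_geN1 x : -1 <= cosq x. Proof. exact: cos_geN1. Qed.

Lemma cosq1 : 1 - cosq 1 = gap.
Proof. by have := cosq_nat 1; rewrite !mulr1n mulr1 /gap => ->. Qed.

Lemma le_cos_0pi (x y : R) : 0 <= x -> x <= y -> y <= pi -> cos y <= cos x.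
Proof.
move=> x0 xy ypi; rewrite leNgt; apply/negP.
rewrite ltr_cos ?in_itv /= ?x0 ?ypi ?(le_trans xy ypi) ?(le_trans x0 xy) //.
by rewrite ltNge xy.
Qed.

(** [x] and [q - x] have the same cosine, so the angle may be taken between 2 pi / q and pi, where
    the cosine decreases. *)
Lemma gap_le_cosq x : x != 0 -> gap <= 1 - cosq x.
Proof.
have pi0 := @pi_ge0 R.
have q0 : 0 < q%:R :> R by rewrite lt0r q_neq0 ler0n.
have small (k : nat) : (0 < k)%N -> (k.*2 <= q)%N ->
    cos (2 * pi * k%:R / q%:R) <= cos (2 * pi / q%:R) :> R.
  move=> k0 kq; apply: le_cos_0pi.
  - by rewrite divr_ge0 ?mulr_ge0 // ltW.
  - by rewrite ler_pM2r ?invr_gt0 // ler_peMr ?mulr_ge0 // ler1n.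
  - rewrite ler_pdivrMr // [2 * pi]mulrC -mulrA ler_wpM2l //.
    by rewrite -natrM mul2n ler_nat.
move=> x0; rewrite lerD2l lerN2 /cosq.
have xpos : (0 < x)%N by rewrite lt0n; apply: contra x0 => /eqP x0; apply/eqP/val_inj.
have xq : (x < q)%N by rewrite -{2}(Zp_cast q_gt1) ltn_ord.
have [|lt] := leqP (x : nat).*2 q; first exact: small.
have -> : cos (2 * pi * (x : nat)%:R / q%:R) =
   cos (2 * pi * (q - x)%:R / q%:R) :> R.
  rewrite natrB 1?ltnW //.
  have -> : 2 * pi * (q%:R - (x : nat)%:R) / q%:R =
    - (2 * pi * (x : nat)%:R / q%:R) + pi *+ 2 :> R.
    by rewrite -[pi *+ 2]mulr_natr; field.
  by rewrite cosD2pi cosN.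
apply: small; first by rewrite subn_gt0.
by rewrite doubleB leq_subLR -addnn leq_add2r ltnW.
Qed.

Lemma gap_gt0 : 0 < gap.
Proof.
have pi0 := @pi_gt0 R.
have q2 : 2 <= q%:R :> R by rewrite ler_nat.
rewrite subr_gt0 -[ltRHS](@cos0 R) ltr_cos ?in_itv /= ?lexx ?pi_ge0 //.
  by rewrite divr_gt0 ?mulr_gt0 // (lt_le_trans _ q2).
rewrite divr_ge0 ?mulr_ge0 ?pi_ge0 // ler_pdivrMr ?(lt_le_trans _ q2) //=.
by rewrite mulrC ler_wpM2l // ltW.
Qed.

Lemma gap_le2 : gap <= 2.
Proof. by rewrite /gap; have := cos_geN1 (2 * pi / q%:R : R); lra. Qed.

End Characters.

(** * Eigenvalues *)

Lemma natr_card_sum (R : pzSemiRingType) (T : finType) (A : pred T) :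
  #|[set x | A x]|%:R = \sum_x (A x)%:R :> R.
Proof.
rewrite -sum1dep_card natr_sum big_mkcond /=.
by apply: eq_bigr => x _; case: (A x).
Qed.

Lemma sum_sym_pairs (R : pzSemiRingType) (n : nat) (F : 'I_n -> 'I_n -> R) :
  (forall i, F i i = 0) -> (forall i j, F i j = F j i) ->
  \sum_i \sum_j F i j = (\sum_(p in pairs n) F p.1 p.2) *+ 2.
Proof.
move=> F0 Fsym.
have ltE : \sum_(p in pairs n) F p.1 p.2 =
    \sum_(i < n) \sum_(j < n) (if (i < j)%N then F i j else 0).
  rewrite pair_bigA big_mkcond /=.
  by apply: eq_bigr => p _; rewrite inE.
rewrite mulr2n {1}ltE ltE [X in _ = _ + X]exchange_big -big_split /=.
apply: eq_bigr => i _; rewrite -big_split /=; apply: eq_bigr => j _.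
by case: ltngtP => [_|_|/val_inj ->]; rewrite ?addr0 ?add0r ?F0.
Qed.

Section Spectrum.
Variables (R : realType) (n q : nat).
Hypothesis n_gt1 : (1 < n)%N.
Hypothesis q_gt1 : (1 < q)%N.
Local Notation mat := 'M['Z_q]_n.
Local Notation C := (cosq R).
Local Notation S := (sinq R).

Definition mxdot (Y X : mat) : 'Z_q := \sum_i \sum_j Y i j * X i j.

Definition quad (Y : mat) (i i' j j' : 'I_n) : 'Z_q :=
  Y i j - Y i j' - Y i' j + Y i' j'.

(** The fair coin pairs each phase with its opposite, so only the cosine of [quad] survives the
    average. *)
Definition eigval (Y : mat) : R :=
  (\sum_(p in pairs n) \sum_(p' in pairs n) C (quad Y p.1 p.2 p'.1 p'.2))
    / #|pairs n|%:R ^+ 2.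

Lemma mxdotDr Y X X' : mxdot Y (X + X') = mxdot Y X + mxdot Y X'.
Proof.
rewrite /mxdot -big_split; apply: eq_bigr => i _; rewrite -big_split.
by apply: eq_bigr => j _; rewrite mxE mulrDr.
Qed.

Lemma mxdotNr Y X : mxdot Y (- X) = - mxdot Y X.
Proof.
rewrite /mxdot -sumrN; apply: eq_bigr => i _; rewrite -sumrN.
by apply: eq_bigr => j _; rewrite mxE mulrN.
Qed.

Lemma mxdotC Y X : mxdot Y X = mxdot X Y.
Proof. by apply: eq_bigr => i _; apply: eq_bigr => j _; rewrite mulrC. Qed.

Lemma mxdotDl Y Y' X : mxdot (Y + Y') X = mxdot Y X + mxdot Y' X.
Proof. by rewrite mxdotC mxdotDr !(mxdotC X). Qed.

Lemma mxdotNl Y X : mxdot (- Y) X = - mxdot Y X.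
Proof. by rewrite mxdotC mxdotNr (mxdotC X). Qed.

Lemma mxdot_delta Y i j : mxdot Y (delta_mx i j) = Y i j.
Proof.
rewrite /mxdot (bigD1 i) //= (bigD1 j) //= mxE !eqxx mulr1 big1 => [|k kj].
  rewrite big1 ?addr0 // => k ki; rewrite big1 // => l _.
  by rewrite mxE (negPf ki) mulr0.
by rewrite mxE (negPf kj) andbF mulr0.
Qed.

Lemma mxdot_Tmx Y p p' :
  mxdot Y (Tmx q p p') = - quad Y p.1 p.2 p'.1 p'.2.
Proof. by rewrite /Tmx !(mxdotDr, mxdotNr) !mxdot_delta /quad; ring. Qed.

Lemma card_pairs : n%:R * (n%:R - 1) = #|pairs n|%:R *+ 2 :> R.
Proof.
rewrite [#|_|%:R]natr_card_sum.
have -> : \sum_(p : 'I_n * 'I_n) ((p.1 < p.2)%N)%:R =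
    \sum_(p in pairs n) (p.1 != p.2)%:R :> R.
  rewrite [RHS]big_mkcond; apply: eq_bigr => p _; rewrite inE.
  by case: ltnP => // lt; rewrite neq_ltn lt.
rewrite -(sum_sym_pairs (F := fun i j => (i != j)%:R)); last first.
- by move=> i j; rewrite eq_sym.
- by move=> i; rewrite eqxx.
transitivity (\sum_(i < n) (n%:R - 1 : R)).
  by rewrite sumr_const card_ord ?expr2 mulr_natl.
apply: eq_bigr => i _; apply/eqP; rewrite subr_eq; apply/eqP.
rewrite (bigD1 i) //= eqxx add0r.
transitivity (\sum_(j < n) (1 : R)); first by rewrite sumr_const card_ord.
rewrite (bigD1 i) //= addrC; congr (_ + _).
by apply: eq_bigr => j; rewrite eq_sym => ->.
Qed.

Lemma card_pairs_gt0 : 0 < #|pairs n|%:R :> R.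
Proof.
have n2 : 2 <= n%:R :> R by rewrite ler_nat.
suff : 0 < #|pairs n|%:R *+ 2 :> R by rewrite pmulrn_lgt0.
by rewrite -card_pairs mulr_gt0; lra.
Qed.

(** Quadruples with a repeated row or column have [quad] 0 and contribute nothing; the four
    orderings of any other one contribute equally. Sums over free indices factor more easily than
    sums over pairs. *)
Lemma eigval_gap Y :
  n%:R ^+ 2 * (n%:R - 1) ^+ 2 * (1 - eigval Y) =
  \sum_i \sum_i' \sum_j \sum_j' (1 - C (quad Y i i' j j')).
Proof.
rewrite (sum_sym_pairs (F := fun i i' => \sum_j \sum_j' _)); last first.
- move=> i i'; apply: eq_bigr => j _; apply: eq_bigr => j' _.
  by rewrite -(cosqN R q_gt1 (quad Y i' _ _ _)); congr (1 - C _); rewrite /quad; ring.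
- move=> i; rewrite big1 // => j _; rewrite big1 // => j' _.
  have -> : quad Y i i j j' = 0 by rewrite /quad; ring.
  by rewrite cosq0 subrr.
under eq_bigr => p _.
  rewrite (sum_sym_pairs (F := fun j j' => 1 - C (quad Y p.1 p.2 j j'))); last first.
  - move=> j j'; rewrite -(cosqN R q_gt1 (quad Y _ _ _ j)).
    by congr (1 - C _); rewrite /quad; ring.
  - move=> j; have -> : quad Y p.1 p.2 j j = 0 by rewrite /quad; ring.
    by rewrite cosq0 subrr.
  over.
under eq_bigr => p _ do rewrite big_split /= sumr_const sumrN.
rewrite sumrMnl big_split /= sumr_const sumrN -exprMn card_pairs /eigval.
have := card_pairs_gt0; set N := #|_|%:R => N0.
rewrite -[N *+ #|_|]mulr_natr -/N.
by field; rewrite gt_eqF.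
Qed.

(** Both sides are the squared modulus of the sum of exp (2 i pi f / q). *)
Lemma sum_cosq_sub (I : finType) (f : I -> 'Z_q) :
  \sum_i \sum_j C (f i - f j) = (\sum_i C (f i)) ^+ 2 + (\sum_i S (f i)) ^+ 2.
Proof.
rewrite !expr2 !big_distrlr /= -big_split; apply: eq_bigr => i _ /=.
rewrite -big_split; apply: eq_bigr => j _ /=.
by rewrite cosqB.
Qed.

(** For fixed rows, the sum over the two columns is a squared modulus, hence nonnegative; equal rows
    alone contribute n ^ 3. *)
Lemma eigval_ge Y : - (n%:R - 1)^-1 <= eigval Y.
Proof.
have n2 : 2 <= n%:R :> R by rewrite ler_nat.
have := eigval_gap Y.
rewrite [RHS](_ : _ = n%:R ^+ 4 -
  \sum_i \sum_i' \sum_j \sum_j' C (quad Y i i' j j')); last first.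
  rewrite -sumrN (_ : n%:R ^+ 4 = \sum_(i < n) n%:R ^+ 3); last first.
    by rewrite sumr_const card_ord exprS mulr_natl.
  rewrite -big_split; apply: eq_bigr => i _ /=.
  rewrite -sumrN (_ : n%:R ^+ 3 = \sum_(i < n) n%:R ^+ 2); last first.
    by rewrite sumr_const card_ord exprS mulr_natl.
  rewrite -big_split; apply: eq_bigr => i' _ /=.
  rewrite -sumrN (_ : n%:R ^+ 2 = \sum_(i < n) n%:R); last first.
    by rewrite sumr_const card_ord ?expr2 mulr_natl.
  rewrite -big_split; apply: eq_bigr => j _ /=.
  by rewrite -sumrN big_split /= sumr_const card_ord.
suff : n%:R ^+ 3 <= \sum_i \sum_i' \sum_j \sum_j' C (quad Y i i' j j').
  set T := \sum_i _ => T3 E.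
  have : n%:R ^+ 2 * (n%:R - 1) ^+ 2 * (1 - eigval Y)
    <= n%:R ^+ 2 * (n%:R - 1) ^+ 2 * (1 + (n%:R - 1)^-1).
    rewrite E (le_trans (y := n%:R ^+ 4 - n%:R ^+ 3)) ?lerD2l ?lerN2 //.
    by rewrite le_eqVlt; apply/orP; left; apply/eqP; field; lra.
  rewrite ler_pM2l; last by rewrite mulr_gt0 // exprn_gt0 //; lra.
  by lra.
rewrite exprS mulr_natl -[X in _ *+ X](card_ord n) -sumr_const.
apply: ler_sum => i _; rewrite (bigD1 i) //= -[leLHS]addr0.
apply: lerD; last first.
  apply: sumr_ge0 => i' _.
  rewrite [leRHS](_ : _ = (\sum_j C (Y i j - Y i' j)) ^+ 2 +
    (\sum_j S (Y i j - Y i' j)) ^+ 2); first by rewrite addr_ge0 ?sqr_ge0.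
  rewrite -sum_cosq_sub; apply: eq_bigr => j _; apply: eq_bigr => j' _.
  by rewrite /quad; congr C; ring.
rewrite expr2 mulr_natl -[X in _ *+ X](card_ord n) -sumr_const.
apply: ler_sum => j _; rewrite -[X in _ *+ X](card_ord n) -sumr_const.
apply: ler_sum => j' _; have -> : quad Y i i j j' = 0 by rewrite /quad; ring.
by rewrite cosq0.
Qed.

End Spectrum.

(** * The walk in the eigenbasis *)

Section CosSums.
Variables (R : realType) (q : nat).
Hypothesis q_gt1 : (1 < q)%N.
Local Notation C := (cosq R).

(* The sum [F phi] satisfies [F (phi + d) = F phi], while
   [F (phi + d) + F (phi - d) = 2 * C d * F phi] and [C d < 1]. *)
Lemma sum_cosq_shift_eq0 (I : finType) (P : pred I) (g : I -> 'Z_q) (d : 'Z_q) :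
  d != 0 ->
  (forall phi, \sum_(x | P x) C (g x + (d + phi)) = \sum_(x | P x) C (g x + phi)) ->
  forall phi, \sum_(x | P x) C (g x + phi) = 0.
Proof.
move=> d0 shift phi.
have Cd1 : 0 < 1 - C d by apply: lt_le_trans (gap_le_cosq R q_gt1 d0); apply: gap_gt0.
have := shift phi; have := shift (phi - d).
rewrite [d + (_ - d)]addrC subrK => E1 E2.
set F := \sum_(x | P x) C (g x + phi) in E1 E2 *.
have : F + F = 2 * C d * F.
  rewrite {1}E1 -{1}E2 -big_split /= mulr_sumr; apply: eq_bigr => x _.
  have -> : g x + (phi - d) = (g x + phi) - d by ring.
  have -> : g x + (d + phi) = (g x + phi) + d by ring.
  by move: (g x + phi) => u; rewrite cosqB // cosqD //; ring.
move=> E; have : (1 - C d) * F = 0 by lra.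
by move/eqP; rewrite mulf_eq0 gt_eqF //= => /eqP.
Qed.

End CosSums.

Lemma sqr_sum_norm_le (R : realFieldType) (I : finType) (A : {set I}) (a : I -> R) :
  (\sum_(x in A) `|a x|) ^+ 2 <= #|A|%:R * \sum_(x in A) a x ^+ 2.
Proof.
have [A0|A0] := eqVneq #|A| 0%N.
  by rewrite (cards0_eq A0) !big_set0 expr0n mulr0.
have N0 : 0 < #|A|%:R :> R by rewrite ltr0n lt0n.
set s := \sum_(x in A) `|a x|; set N := #|A|%:R in N0 *.
(* The deviations of the absolute values from their mean [s / N] have a nonnegative sum of
   squares. *)
have : 0 <= \sum_(x in A) (`|a x| - s / N) ^+ 2.
  by apply: sumr_ge0 => x _; rewrite sqr_ge0.
rewrite (_ : \sum_(x in A) _ = \sum_(x in A) a x ^+ 2 - s ^+ 2 / N); last first.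
  transitivity (\sum_(x in A) (a x ^+ 2 + (`|a x| * (- (2 * s / N)) + (s / N) ^+ 2))).
    apply: eq_bigr => x _; rewrite -(real_normK (num_real (a x))).
    by field; rewrite gt_eqF.
  rewrite big_split big_split /= -mulr_suml sumr_const -[_ *+ _]mulr_natr -/s -/N.
  by field; rewrite gt_eqF.
by rewrite subr_ge0 ler_pdivrMr // mulrC.
Qed.

Section Walk.
Variables (R : realType) (n q : nat).
Hypothesis n_gt1 : (1 < n)%N.
Hypothesis q_gt1 : (1 < q)%N.
Local Notation mat := 'M['Z_q]_n.
Local Notation C := (cosq R).

Lemma sum_step_prob (f : mat -> R) (A : mat) :
  \sum_B step_prob R A B * f B =
  (\sum_(m in moves n) f (apply_move A m)) / #|moves n|%:R.
Proof.
transitivity (\sum_B (\sum_m (((m \in moves n) && (apply_move A m == B))%:R * f B)) / #|moves n|%:R).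
  apply: eq_bigr => B _; rewrite /step_prob natr_card_sum mulrAC.
  by rewrite [in LHS]mulr_suml.
rewrite -mulr_suml exchange_big /=; congr (_ / _).
rewrite [RHS]big_mkcond; apply: eq_bigr => m _.
rewrite (bigD1 (apply_move A m)) //= eqxx andbT big1 ?addr0 => [|B /negPf Bm].
  by case: ifP => _; rewrite (mul0r, mul1r).
by rewrite eq_sym Bm andbF mul0r.
Qed.

Lemma sum_moves (f : 'I_n * 'I_n -> 'I_n * 'I_n -> bool -> R) :
  \sum_(m in moves n) f m.1.1 m.1.2 m.2 =
  \sum_(p in pairs n) \sum_(p' in pairs n) (f p p' true + f p p' false).
Proof.
transitivity (\sum_(p in pairs n) \sum_(p' in pairs n) \sum_(b : bool) f p p' b).
  rewrite pair_big pair_big /=; apply: eq_big => [m|//].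
  by rewrite !inE andbT.
by apply: eq_bigr => p _; apply: eq_bigr => p' _; rewrite big_bool.
Qed.

(** The two outcomes of the coin move the phase by [d] and [- d], and cos (u + d) + cos (u - d) = 2
    cos d cos u. The free phase [phi] replaces the complex values of a character. *)
Lemma sum_step_cosq (Y A : mat) phi :
  \sum_B step_prob R A B * C (mxdot Y B + phi) =
  eigval R Y * C (mxdot Y A + phi).
Proof.
rewrite sum_step_prob.
pose f p p' b := C (mxdot Y (apply_move A (p, p', b)) + phi).
rewrite (eq_bigr (fun m => f m.1.1 m.1.2 m.2)); last by case=> [[]].
rewrite sum_moves /f /apply_move /=.
transitivity ((\sum_(p in pairs n) \sum_(p' in pairs n)
    C (quad Y p.1 p.2 p'.1 p'.2) * (2 * C (mxdot Y A + phi))) / #|moves n|%:R).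
  congr (_ / _); apply: eq_bigr => p _; apply: eq_bigr => p' _.
  rewrite (mxdotDr Y A (Tmx q p p')) (mxdotDr Y A (- _)) mxdotNr mxdot_Tmx opprK.
  set d := quad _ _ _ _ _.
  have -> : mxdot Y A - d + phi = (mxdot Y A + phi) - d by ring.
  have -> : mxdot Y A + d + phi = (mxdot Y A + phi) + d by ring.
  by rewrite cosqB // (cosqD R q_gt1 (mxdot Y A + phi) d); ring.
under eq_bigr => p _ do rewrite -mulr_suml.
rewrite -mulr_suml /eigval !cardsX cardsT card_bool !natrM.
have := card_pairs_gt0 R n_gt1; set N := #|_|%:R => N0.
by field; rewrite gt_eqF.
Qed.

Lemma sum_walk_cosq (Y A : mat) t phi :
  \sum_B walk_prob R t A B * C (mxdot Y B + phi) =
  eigval R Y ^+ t * C (mxdot Y A + phi).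
Proof.
elim: t => [|t IHt] /=.
  rewrite expr0 (bigD1 A) //= eqxx big1 ?addr0 // => B BA.
  by rewrite eq_sym (negPf BA) mul0r.
under eq_bigr => B _ do rewrite mulr_suml.
rewrite exchange_big /= exprS -mulrA -IHt mulr_sumr; apply: eq_bigr => D _.
under eq_bigr => B _ do rewrite -mulrA.
by rewrite -mulr_sumr sum_step_cosq mulrCA.
Qed.

Lemma quad0 (i i' j j' : 'I_n) : quad (0 : mat) i i' j j' = 0.
Proof. by rewrite /quad !mxE; ring. Qed.

Lemma mxdot0l (X : mat) : mxdot 0 X = 0.
Proof. by apply: big1 => i _; apply: big1 => j _; rewrite mxE mul0r. Qed.

Lemma eigval0 : eigval R (0 : mat) = 1.
Proof.
have := eigval_gap R n_gt1 q_gt1 0.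
rewrite big1 => [|i _]; last first.
  by do 3!(apply: big1 => ? _); rewrite quad0 cosq0 subrr.
have n2 : 2 <= n%:R :> R by rewrite ler_nat.
have N0 : 0 < n%:R ^+ 2 * (n%:R - 1) ^+ 2 :> R.
  by rewrite mulr_gt0 // exprn_gt0 //; lra.
by move/eqP; rewrite mulf_eq0 gt_eqF //= subr_eq0 => /eqP.
Qed.

Lemma sum_walk_prob (A : mat) t : \sum_B walk_prob R t A B = 1.
Proof.
have := sum_walk_cosq 0 A t 0; rewrite eigval0 expr1n mxdot0l addr0 cosq0 mulr1.
move=> <-; apply: eq_bigr => B _.
by rewrite mxdot0l addr0 cosq0 mulr1.
Qed.

Lemma walk_prob_ge0 (A B : mat) t : 0 <= walk_prob R t A B.
Proof.
elim: t B => [|t IHt] B /=; first by rewrite ler0n.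
by apply: sumr_ge0 => D _; rewrite mulr_ge0 // divr_ge0 ?ler0n.
Qed.

(** * Fourier inversion and Plancherel on the set of tables *)

Section Margins.
Variables (r s : 'I_n -> 'Z_q).
Local Notation Omega := (tables r s).

Lemma walk_prob_out (A B : mat) t :
  A \in Omega -> B \notin Omega -> walk_prob R t A B = 0.
Proof.
move=> AO; elim: t B => [|t IHt] B BO /=.
  by case: eqP => // AB; rewrite -AB AO in BO.
apply: big1 => D _; have [DO|DO] := boolP (D \in Omega); last first.
  by rewrite IHt // mul0r.
rewrite /step_prob (_ : [set m in moves n | _] = set0) ?cards0 ?mul0r ?mulr0 //.
apply/setP => m; rewrite !inE; apply/negbTE/negP => /andP[_ /eqP E].
by move: BO; rewrite -E apply_move_tables.
Qed.

Lemma sum_walk_tables (A : mat) t (f : mat -> R) : A \in Omega ->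
  \sum_(B in Omega) walk_prob R t A B * f B = \sum_B walk_prob R t A B * f B.
Proof.
move=> AO; rewrite big_mkcond /=; apply: eq_bigr => B _.
by case: ifPn => // BO; rewrite walk_prob_out // mul0r.
Qed.

(** Adding [Tmx] permutes the tables and shifts their pairing with [Y] by a nonzero amount. *)
Lemma sum_tables_cosq_eq0 (Y : mat) i i' j j' phi :
  quad Y i i' j j' != 0 -> \sum_(B in Omega) C (mxdot Y B + phi) = 0.
Proof.
move=> Y0; apply: (sum_cosq_shift_eq0 q_gt1 Y0) => {}phi.
pose T : mat := Tmx q (i, i') (j, j').
rewrite [RHS](reindex_inj (addIr (- T))) /=; apply: eq_big => [B|B BO].
  apply/idP/idP => BO.
    exact: (apply_move_tables ((i, i'), (j, j'), false)) BO.
  by have := apply_move_tables ((i, i'), (j, j'), true) BO; rewrite /apply_move /= subrK.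
by rewrite mxdotDr mxdotNr mxdot_Tmx opprK /=; congr C; ring.
Qed.

Section Frequencies.
Variable i0 : 'I_n.

(** Adding row and column constants to [Y] does not change its pairing with differences of tables.
    Each class modulo such constants has exactly one member in [freqs], which thus lists the
    characters of the group of zero-margin matrices. *)
Definition freqs : {set mat} :=
  [set Y : mat | [forall i, (Y i i0 == 0) && (Y i0 i == 0)]].

Lemma freqsP (Y : mat) : reflect (forall i, Y i i0 = 0 /\ Y i0 i = 0) (Y \in freqs).
Proof.
rewrite inE; apply: (iffP forallP) => Y0 i.
  by have /andP[/eqP -> /eqP ->] := Y0 i.
by have [-> ->] := Y0 i; rewrite !eqxx.
Qed.

Lemma freqs_quad (Y : mat) i j : Y \in freqs -> quad Y i i0 j i0 = Y i j.
Proof.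
by move=> /freqsP Y0; rewrite /quad; have [-> _] := Y0 i; rewrite !(Y0 _).2; ring.
Qed.

Lemma mx_neq0P (Y : mat) : Y != 0 -> exists i j, Y i j != 0.
Proof.
move=> Y0; case: (pickP (fun p : 'I_n * 'I_n => Y p.1 p.2 != 0)) => [p Yp|Y0'].
  by exists p.1, p.2.
case/eqP: Y0; apply/matrixP => i j; rewrite mxE; apply/eqP.
by have /negbFE := Y0' (i, j).
Qed.

(** [A - B] is nonzero with zero margins, so it has a nonzero entry outside row and column [i0].
    Shifting [Y] at that entry permutes [freqs] and changes the phase. *)
Lemma sum_freqs_cosq_eq0 (A B : mat) : A \in Omega -> B \in Omega -> A != B ->
  \sum_(Y in freqs) C (mxdot Y (A - B)) = 0.
Proof.
rewrite !inE => /andP[/forallP Ar /forallP As] /andP[/forallP Br /forallP Bs] AB.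
set X := A - B.
have Xr i : \sum_j X i j = 0.
  under eq_bigr => j _ do rewrite !mxE.
  by rewrite sumrB (eqP (Ar i)) (eqP (Br i)) subrr.
have Xs j : \sum_i X i j = 0.
  under eq_bigr => i _ do rewrite !mxE.
  by rewrite sumrB (eqP (As j)) (eqP (Bs j)) subrr.
have [[i j] /= /and3P[ii0 ji0 Xij]|X0] :=
    pickP (fun p => [&& p.1 != i0, p.2 != i0 & X p.1 p.2 != 0]).
  have -> : \sum_(Y in freqs) C (mxdot Y X) = \sum_(Y in freqs) C (mxdot Y X + 0).
    by under [RHS]eq_bigr do rewrite addr0.
  apply: (sum_cosq_shift_eq0 q_gt1 Xij) => phi.
  rewrite [RHS](reindex_inj (addIr (delta_mx i j))) /=; apply: eq_big => [Y|Y YW].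
    have Y1 k : (Y + delta_mx i j) k i0 = Y k i0.
      by rewrite !mxE [i0 == j]eq_sym (negPf ji0) andbF addr0.
    have Y2 k : (Y + delta_mx i j) i0 k = Y i0 k.
      by rewrite !mxE [i0 == i]eq_sym (negPf ii0) addr0.
    by rewrite !inE; apply: eq_forallb => k; rewrite Y1 Y2.
  by rewrite mxdotDl (mxdotC (delta_mx i j)) mxdot_delta addrA.
(* With no such entry, the zero margins force row and column [i0] of [X] to vanish too. *)
case/eqP: AB; apply: subr0_eq; apply/matrixP => i j; rewrite -/X [RHS]mxE.
have X1 k l : k != i0 -> l != i0 -> X k l = 0.
  by move=> k0 l0; have /negbT := X0 (k, l); rewrite /= k0 l0 /= negbK => /eqP.
have X2 k : k != i0 -> X k i0 = 0.
  by move=> k0; have := Xr k; rewrite (bigD1 i0) //= big1 ?addr0 // => l; apply: X1.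
have [->|ji0] := eqVneq j i0.
  by have := Xs i0; have [->|/X2//] := eqVneq i i0; rewrite (bigD1 i0) //= big1 ?addr0.
have [->|ii0] := eqVneq i i0; last exact: X1.
by have := Xs j; rewrite (bigD1 i0) //= big1 ?addr0 // => k k0; apply: X1.
Qed.

(** Double counting: summed over [Y] first, only [B = A] survives; summed over [B] first, only
    [Y = 0]. *)
Lemma card_freqs : Omega != set0 -> #|freqs| = #|Omega|.
Proof.
case/set0Pn => A AO; apply/eqP; rewrite -(eqr_nat R); apply/eqP.
transitivity (\sum_(B in Omega) \sum_(Y in freqs) C (mxdot Y (A - B))).
  rewrite (bigD1 A) //= [X in _ + X]big1 => [|B /andP[BO BA]]; last first.
    by apply: sum_freqs_cosq_eq0 => //; rewrite eq_sym.
  rewrite addr0 subrr -sumr_const; apply: eq_bigr => Y _.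
  by rewrite -[mxdot Y 0]/(mxdot Y 0) mxdotC mxdot0l cosq0.
rewrite exchange_big /= (bigD1 0) /=; last by apply/freqsP => i; rewrite !mxE.
rewrite [X in _ + X = _]big1 ?addr0 => [|Y /andP[YW /mx_neq0P[i [j Yij]]]].
  by rewrite -sumr_const; apply: eq_bigr => B _; rewrite mxdot0l cosq0.
transitivity (\sum_(B in Omega) C (mxdot Y B + - mxdot Y A)).
  by apply: eq_bigr => B _; rewrite mxdotDr mxdotNr -cosqN // opprB.
by apply: (@sum_tables_cosq_eq0 Y i i0 j i0); rewrite freqs_quad.
Qed.

(** Fourier inversion: by orthogonality the indicator of [B] is an average of cosines over [freqs],
    each of which is an eigenfunction. *)
Lemma walk_probE (A B : mat) t : A \in Omega -> B \in Omega ->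
  walk_prob R t A B =
  #|Omega|%:R^-1 * \sum_(Y in freqs) eigval R Y ^+ t * C (mxdot Y (A - B)).
Proof.
move=> AO BO.
have O0 : Omega != set0 by apply/set0Pn; exists A.
have N0 : #|Omega|%:R != 0 :> R by rewrite pnatr_eq0 cards_eq0.
transitivity (\sum_(D in Omega) walk_prob R t A D *
    (#|Omega|%:R^-1 * \sum_(Y in freqs) C (mxdot Y (D - B)))).
  rewrite (bigD1 B) //= [X in _ = _ + X]big1 => [|D /andP[DO DB]]; last first.
    by rewrite sum_freqs_cosq_eq0 // !mulr0.
  rewrite subrr (eq_bigr (fun=> 1)) => [|Y _]; last by rewrite mxdotC mxdot0l cosq0.
  by rewrite sumr_const card_freqs // mulVf // mulr1 addr0.
rewrite (sum_walk_tables _ _ AO) [in RHS]mulr_sumr.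
under eq_bigr => D _ do rewrite mulrCA mulr_sumr mulr_sumr.
rewrite exchange_big /=; apply: eq_bigr => Y _.
rewrite -mulr_sumr mxdotDr -sum_walk_cosq; congr (_ * _).
by apply: eq_bigr => D _; rewrite mxdotDr.
Qed.

(** Plancherel. One factor of each square is expanded by [walk_probE], and the other then averages
    an eigenfunction; the frequency 0 cancels against the uniform law. *)
Lemma l2_dist_walk (A : mat) t : A \in Omega ->
  #|Omega|%:R * \sum_(B in Omega) (walk_prob R t A B - #|Omega|%:R^-1) ^+ 2 =
  \sum_(Y in freqs | Y != 0) eigval R Y ^+ (2 * t).
Proof.
move=> AO.
have N0 : #|Omega|%:R != 0 :> R.
  by rewrite pnatr_eq0 cards_eq0; apply/set0Pn; exists A.
set N := #|Omega|%:R in N0 *.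
have sP : \sum_(B in Omega) walk_prob R t A B = 1.
  rewrite -[RHS](sum_walk_prob A t).
  have := sum_walk_tables t (fun=> 1) AO.
  by under eq_bigr do rewrite mulr1; move=> ->; apply: eq_bigr => B _; rewrite mulr1.
have sPP : \sum_(B in Omega) walk_prob R t A B ^+ 2 =
    N^-1 * \sum_(Y in freqs) eigval R Y ^+ (2 * t).
  transitivity (\sum_(B in Omega) walk_prob R t A B *
      (N^-1 * \sum_(Y in freqs) eigval R Y ^+ t * C (mxdot Y (A - B)))).
    by apply: eq_bigr => B BO; rewrite -(walk_probE _ AO BO).
  rewrite (sum_walk_tables _ _ AO) mulr_sumr.
  under eq_bigr => B _ do rewrite mulrCA mulr_sumr mulr_sumr.
  rewrite exchange_big /=; apply: eq_bigr => Y _; rewrite -mulr_sumr; congr (_ * _).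
  under eq_bigr => B _ do rewrite mulrCA.
  rewrite -mulr_sumr mul2n -addnn exprD; congr (_ * _).
  rewrite -[RHS]mulr1 -(cosq0 R q) -[X in C X](subrr (mxdot Y A)) -sum_walk_cosq.
  by apply: eq_bigr => B _; rewrite mxdotDr mxdotNr -[C (_ + - mxdot Y A)]cosqN // opprB.
transitivity (N * (\sum_(B in Omega) (walk_prob R t A B ^+ 2 +
    (walk_prob R t A B * (- (2 / N)) + N^-1 ^+ 2)))).
  by congr (_ * _); apply: eq_bigr => B _; field.
rewrite big_split big_split /= -mulr_suml sP sPP sumr_const -[_ *+ _]mulr_natr -/N.
rewrite (bigD1 0) /=; last by apply/freqsP => i; rewrite !mxE.
by rewrite eigval0 expr1n; field.
Qed.

Lemma sqr_tv_dist_le (A : mat) t : A \in Omega ->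
  (2 * tv_dist Omega (walk_prob R t A) (unif_prob R r s)) ^+ 2 <=
  \sum_(Y in freqs | Y != 0) eigval R Y ^+ (2 * t).
Proof.
move=> AO; rewrite /tv_dist mulVKf ?pnatr_eq0 // -(l2_dist_walk _ AO).
apply: le_trans (sqr_sum_norm_le _ _) _; rewrite ler_wpM2l //.
by apply: ler_sum => B BO; rewrite /unif_prob BO mul1r.
Qed.

End Frequencies.

Lemma tables_neq0 : \sum_i r i = \sum_j s j -> Omega != set0.
Proof.
move=> rs; have i0 : 'I_n by exists 0%N; apply: ltnW.
pose a := \sum_(i | i != i0) r i.
(* The margins are placed along row and column [i0]. The corner corrects column [i0], and row [i0]
   is then right because the totals agree. *)
pose A : mat := \matrix_(i, j)
  if i == i0 then s j - (if j == i0 then a else 0) else if j == i0 then r i else 0.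
apply/set0Pn; exists A; rewrite inE; apply/andP; split; apply/forallP => i; apply/eqP.
  have [->|ii0] := eqVneq i i0.
    under eq_bigr do rewrite mxE eqxx.
    rewrite sumrB -big_mkcond big_pred1_eq -rs.
    by rewrite (bigD1 i0) //= addrK.
  under eq_bigr do rewrite mxE (negPf ii0).
  by rewrite -big_mkcond big_pred1_eq.
rewrite (bigD1 i0) //= mxE eqxx.
have -> : \sum_(k | k != i0) A k i = if i == i0 then a else 0.
  case: ifP => ii0; [|rewrite big1 //]; first apply: eq_bigr => k k0.
    by rewrite mxE (negPf k0) ii0.
  by move=> k k0; rewrite mxE (negPf k0) ii0.
by rewrite subrK.
Qed.

End Margins.
End Walk.

(** * Sparse frequencies *)

Section Sparsity.
Variables (R : realType) (n q : nat).
Hypothesis n_gt1 : (1 < n)%N.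
Hypothesis q_gt1 : (1 < q)%N.
Local Notation mat := 'M['Z_q]_n.
Local Notation C := (cosq R).
Implicit Types Y Z : mat.

Definition weight Z : R := \sum_i \sum_j (Z i j != 0)%:R.
Definition row_deg Z i : R := \sum_j (Z i j != 0)%:R.
Definition col_deg Z j : R := \sum_i (Z i j != 0)%:R.
Definition nquads Y : R := \sum_i \sum_i' \sum_j \sum_j' (quad Y i i' j j' != 0)%:R.

Lemma gap_nquads_le Y : gap R q * nquads Y <= n%:R ^+ 4 * (1 - eigval R Y).
Proof.
have n2 : 2 <= n%:R :> R by rewrite ler_nat.
have le : gap R q * nquads Y <= n%:R ^+ 2 * (n%:R - 1) ^+ 2 * (1 - eigval R Y).
  rewrite (eigval_gap R n_gt1 q_gt1) /nquads !mulr_sumr; apply: ler_sum => i _.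
  rewrite !mulr_sumr; apply: ler_sum => i' _.
  rewrite !mulr_sumr; apply: ler_sum => j _.
  rewrite !mulr_sumr; apply: ler_sum => j' _.
  have [->|d0] := eqVneq; first by rewrite mulr0 cosq0 subrr.
  by rewrite mulr1 gap_le_cosq.
have ge0 : 0 <= 1 - eigval R Y.
  have : 0 <= gap R q * nquads Y.
    rewrite mulr_ge0 ?(ltW (gap_gt0 R q_gt1)) //.
    by do 4!(apply: sumr_ge0 => ? _); rewrite ler0n.
  move/le_trans => /(_ _ le); rewrite pmulr_rge0 // mulr_gt0 // exprn_gt0 //; lra.
apply: le_trans le _; rewrite ler_wpM2r // (exprD _ 2 2) ler_wpM2l ?exprn_ge0 //.
by rewrite lerXn2r ?nnegrE //; lra.
Qed.

(** The representative of [Y] modulo row and column constants whose row [p.1] and column [p.2]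
    vanish. *)
Definition rebase Y (p : 'I_n * 'I_n) : mat := \matrix_(i, j) quad Y i p.1 j p.2.

Lemma quad_rebase Y p i i' j j' : quad (rebase Y p) i i' j j' = quad Y i i' j j'.
Proof. by rewrite /quad !mxE /quad; ring. Qed.

Lemma nquads_rebase Y p : nquads (rebase Y p) = nquads Y.
Proof. by do 4!(apply: eq_bigr => ? _); rewrite quad_rebase. Qed.

Lemma nquads_sum_rebase Y : nquads Y = \sum_p weight (rebase Y p).
Proof.
rewrite -(pair_bigA _ (fun i1 j1 => weight (rebase Y (i1, j1)))) /= exchange_big /=.
rewrite /nquads exchange_big /= [RHS]exchange_big /=; apply: eq_bigr => i' _.
under eq_bigr => i _ do rewrite exchange_big.
rewrite exchange_big /=; apply: eq_bigr => j' _.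
by apply: eq_bigr => i _; apply: eq_bigr => j _; rewrite mxE.
Qed.

Definition sparse_base (p0 : 'I_n * 'I_n) Y := [arg min_(p < p0) weight (rebase Y p)]%O.

(** The quadruples with nonzero [quad] correspond to the nonzero entries of all n ^ 2 rebased
    matrices together, and the least weight is at most the average. *)
Lemma weight_sparse_le p0 Y :
  n%:R ^+ 2 * weight (rebase Y (sparse_base p0 Y)) <= nquads Y.
Proof.
rewrite nquads_sum_rebase /sparse_base; case: arg_minP => // p _ pmin.
apply: le_trans (_ : \sum_(p' : 'I_n * 'I_n) weight (rebase Y p) <= _).
  by rewrite sumr_const card_prod !card_ord -natrX mulr_natl mulnn.
by apply: ler_sum => p' _; apply: pmin.
Qed.

Lemma weight_ge1 Z : Z != 0 -> 1 <= weight Z.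
Proof.
case/mx_neq0P => i [j Zij]; rewrite /weight (bigD1 i) //= (bigD1 j) //= Zij.
rewrite -addrA lerDl addr_ge0 //; first by apply: sumr_ge0.
by apply: sumr_ge0 => k _; apply: sumr_ge0.
Qed.

(** [Y] is recovered from any rebased form without knowing the base, so passing to a sparsest one is
    injective on [freqs]. *)
Lemma rebase_freqs i0 Y p i j : Y \in freqs q i0 -> Y i j = quad (rebase Y p) i i0 j i0.
Proof. by move=> YW; rewrite quad_rebase freqs_quad. Qed.

Variable h : R.
Definition heavy_rows Z : {set 'I_n} := [set i | h < row_deg Z i].
Definition heavy_cols Z : {set 'I_n} := [set j | h < col_deg Z j].
Definition light_at Z i j : bool :=
  [&& i \notin heavy_rows Z, j \notin heavy_cols Z & Z i j != 0].
Definition light_weight Z : R := \sum_i \sum_j (light_at Z i j)%:R.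

Lemma weight_rows Z : weight Z = \sum_i row_deg Z i.
Proof. by []. Qed.

Lemma weight_cols Z : weight Z = \sum_j col_deg Z j.
Proof. exact: exchange_big. Qed.

Lemma heavy_rows_le Z : h * #|heavy_rows Z|%:R <= weight Z.
Proof.
rewrite weight_rows mulr_natr -sumr_const [leLHS]big_mkcond; apply: ler_sum => i _.
case: ifP; first by rewrite inE => /ltW.
by move=> _; apply: sumr_ge0.
Qed.

Lemma heavy_cols_le Z : h * #|heavy_cols Z|%:R <= weight Z.
Proof.
rewrite weight_cols mulr_natr -sumr_const [leLHS]big_mkcond; apply: ler_sum => i _.
case: ifP; first by rewrite inE => /ltW.
by move=> _; apply: sumr_ge0.
Qed.

Lemma light_weight_ge0 Z : 0 <= light_weight Z.
Proof. by apply: sumr_ge0 => i _; apply: sumr_ge0. Qed.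

Lemma light_weight_le Z : light_weight Z <= weight Z.
Proof.
apply: ler_sum => i _; apply: ler_sum => j _; rewrite ler_nat /light_at.
by case: (Z i j == 0); rewrite ?andbF // leq_b1.
Qed.

(** The light row spoils at most n h pairs [(i', j')], the light column as many, and a nonzero
    opposite corner [weight Z] of them. *)
Lemma light_count Z i j : light_at Z i j ->
  n%:R ^+ 2 - 2 * n%:R * h - weight Z <=
  \sum_i' \sum_j' [&& Z i j' == 0, Z i' j == 0 & Z i' j' == 0]%:R.
Proof.
case/and3P; rewrite !inE -!leNgt => ri cj _.
apply: le_trans (_ : \sum_i' \sum_j'
  (1 - ((Z i j' != 0)%:R + (Z i' j != 0)%:R + (Z i' j' != 0)%:R) : R) <= _); last first.
  apply: ler_sum => i' _; apply: ler_sum => j' _.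
  by case: (Z i j' == 0); case: (Z i' j == 0); case: (Z i' j' == 0) => /=; lra.
have -> : \sum_i' \sum_j'
    (1 - ((Z i j' != 0)%:R + (Z i' j != 0)%:R + (Z i' j' != 0)%:R) : R) =
    n%:R ^+ 2 - (n%:R * row_deg Z i + n%:R * col_deg Z j + weight Z).
  transitivity (\sum_(i' < n) (n%:R - (row_deg Z i + n%:R * (Z i' j != 0)%:R + row_deg Z i'))).
    apply: eq_bigr => i' _; rewrite sumrB !big_split /= !sumr_const !card_ord.
    by rewrite mulr_natl.
  rewrite sumrB !big_split /= !sumr_const !card_ord -mulr_sumr -weight_rows.
  by rewrite expr2 !mulr_natl.
have n0 : 0 <= n%:R :> R by [].
have := ler_wpM2l n0 ri; have := ler_wpM2l n0 cj; lra.
Qed.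

(* A quadruple in which exactly one of the four entries is nonzero is counted by
   [nquads]; each light entry takes part in many of them, in four positions. *)
Lemma nquads_light Z :
  4 * light_weight Z * (n%:R ^+ 2 - 2 * n%:R * h - weight Z) <= nquads Z.
Proof.
pose e i j i' j' : R :=
  [&& light_at Z i j, Z i j' == 0, Z i' j == 0 & Z i' j' == 0]%:R.
pose E := \sum_i \sum_i' \sum_j \sum_j' e i j i' j'.
have leE : light_weight Z * (n%:R ^+ 2 - 2 * n%:R * h - weight Z) <= E.
  rewrite mulr_suml; apply: ler_sum => i _.
  rewrite exchange_big mulr_suml /=; apply: ler_sum => j _.
  rewrite /e; case: (boolP (light_at Z i j)) => [/light_count|_].
    by rewrite mul1r.
  by rewrite mul0r; apply: sumr_ge0 => i' _; apply: sumr_ge0.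
suff : E + E + E + E <= nquads Z by lra.
have E2 : E = \sum_i \sum_i' \sum_j \sum_j' e i j' i' j.
  by apply: eq_bigr => i _; apply: eq_bigr => i' _; rewrite exchange_big.
have E3 : E = \sum_i \sum_i' \sum_j \sum_j' e i' j i j'.
  by rewrite /E exchange_big.
have E4 : E = \sum_i \sum_i' \sum_j \sum_j' e i' j' i j.
  by rewrite E3; apply: eq_bigr => i _; apply: eq_bigr => i' _; rewrite exchange_big.
rewrite {2}E2 {2}E3 {2}E4 /E.
(* With the nonzero corner in each of the four positions, the four events are disjoint and each
   makes [quad] nonzero, so the bound holds term by term. *)
do 4!(rewrite -!big_split; apply: ler_sum => ? _ /=).
rewrite /e /light_at /quad.
do 4!(case: eqP => [->|/eqP ?]); rewrite ?andbF ?andbT /= ?subr0 ?sub0r ?addr0 ?add0r ?oppr0 ?oppr_eq0;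
  do ?case: (_ \notin _) => /=; rewrite ?addr0 ?add0r ?ler0n ?ler1n ?lt0b //.
Qed.

End Sparsity.

(** * Summation over sparse matrices *)

Lemma sum_prod_mx (R : comPzSemiRingType) (T : finType) (m n : nat)
    (phi : 'I_m -> 'I_n -> T -> R) :
  \sum_(Z : 'M[T]_(m, n)) \prod_i \prod_j phi i j (Z i j) =
  \prod_i \prod_j \sum_z phi i j z.
Proof.
rewrite (pair_bigA _ (fun i j => \sum_z phi i j z)) /= bigA_distr_bigA /=.
rewrite (reindex (fun f : {ffun 'I_m * 'I_n -> T} => \matrix_(i, j) f (i, j))) /=.
  apply: eq_bigr => f _; rewrite (pair_bigA _ (fun i j => phi i j (_ i j))).
  by apply: eq_bigr => -[i j] _; rewrite mxE.
exists (fun Z : 'M[T]_(m, n) => [ffun p => Z p.1 p.2]) => [f _|Z _].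
  by apply/ffunP => -[i j]; rewrite ffunE mxE.
by apply/matrixP => i j; rewrite mxE ffunE.
Qed.

Lemma sum_exp_card_le (R : realFieldType) (n : nat) (b : R) :
  0 <= b <= 1 -> \sum_(I : {set 'I_n}) b ^+ #|I| <= 1 + 2 ^+ n * b.
Proof.
case/andP=> b0 b1; rewrite (bigD1 set0) //= cards0 expr0 lerD2l.
apply: le_trans (_ : \sum_(I : {set 'I_n}) b <= _).
  rewrite [leRHS](bigD1 set0) //= -[leLHS]add0r lerD //.
  apply: ler_sum => I; rewrite -card_gt0; case: #|I| => // k _.
  by rewrite exprS ler_piMr // exprn_ile1.
rewrite sumr_const (_ : #|_| = (2 ^ n)%N); first by rewrite -[leLHS]mulr_natl natrX.
by rewrite -cardsT -powersetT card_powerset cardsT card_ord.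
Qed.

Section SparseSum.
Variables (R : realType) (n q : nat).
Hypothesis n_gt3 : (3 < n)%N.
Hypothesis q_gt1 : (1 < q)%N.
Local Notation mat := 'M['Z_q]_n.
Local Notation N := (n%:R : R).
Local Notation lnq := (ln (q%:R : R)).

Lemma lnq_ge0 : 0 <= lnq.
Proof. by rewrite ln_ge0 // ler1n ltnW. Qed.

Lemma expR_lnq : expR lnq = q%:R.
Proof. by rewrite lnK // posrE ltr0n ltnW. Qed.

Lemma expR_muln_lnq k : expR (- (k%:R * lnq)) = (q%:R ^+ k)^-1.
Proof. by rewrite expRN expRM_natl expR_lnq. Qed.

Lemma card_Zq : #|'Z_q| = q.
Proof. by rewrite card_ord Zp_cast. Qed.

(** [b1] and [b2] tell whether the row and the column are declared heavy. If one is, all q values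
    are allowed, at the price q. Otherwise the nonzero values contribute at most q N ^ (- 2) q ^ (-
    10), so that all N ^ 2 entries together cost a constant factor. *)
Lemma sum_expR_entry_le (s : R) (b1 b2 : bool) : s ^+ 2 = ln N ->
  \sum_(z : 'Z_q)
    expR (- ((2 * s ^+ 2 + 10 * lnq) * [&& ~~ b1, ~~ b2 & z != 0]%:R)) <=
  expR (lnq * b1%:R + lnq * b2%:R + (4 * N ^+ 2)^-1).
Proof.
move=> s2; have N0 : 0 < N by rewrite ltr0n (ltn_trans _ n_gt3).
have q2 : 2 <= q%:R :> R by rewrite ler_nat.
have e0 : 0 <= (4 * N ^+ 2)^-1 by rewrite invr_ge0 mulr_ge0 // sqr_ge0.
have [b12|] := boolP (b1 || b2).
  apply: le_trans (_ : \sum_(z : 'Z_q) 1 <= _).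
    apply: ler_sum => z _; rewrite expR_le1 oppr_le0 mulr_ge0 // addr_ge0 //.
      by rewrite mulr_ge0 // sqr_ge0.
    by rewrite mulr_ge0 ?lnq_ge0.
  rewrite sumr_const card_Zq -[leLHS]expR_lnq ler_expR.
  by have := lnq_ge0; move: b12; case: b1; case: b2 => //= _; lra.
rewrite negb_or => /andP[/negPf -> /negPf ->] /=.
rewrite !mulr0 !add0r (bigD1 0) //= mulr0 oppr0 expR0.
apply: le_trans (expR_ge1Dx _); rewrite lerD2l.
under eq_bigr => z -> do rewrite mulr1.
rewrite sumr_const -[leLHS]mulr_natl.
apply: le_trans (_ : #|'Z_q|%:R * expR (- (2 * s ^+ 2 + 10 * lnq)) <= _).
  by rewrite ler_wpM2r ?expR_ge0 // ler_nat max_card.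
have -> : expR (- (2 * s ^+ 2 + 10 * lnq)) = (N ^+ 2)^-1 * (q%:R ^+ 10)^-1.
  by rewrite opprD expRD expR_muln_lnq s2 expRN expRM_natl lnK.
rewrite card_Zq mulrCA [(4 * _)^-1]invfM [leRHS]mulrC ler_wpM2l ?invr_ge0 ?sqr_ge0 //.
rewrite exprS invfM mulVKf; last lra.
rewrite lef_pV2 ?posrE ?exprn_gt0 //; last lra.
apply: le_trans (_ : 2 ^+ 9 <= _); last by rewrite lerXn2r ?nnegrE //; lra.
by rewrite -natrX ler_nat.
Qed.

(** For fixed sets [I] and [J] of heavy rows and columns, the sum over [Z] factors over entries. The
    term with 311 pays for the values of light entries and for the heavy lines, as N times the
    number of heavy rows, or columns, is at most s times the weight. *)
Lemma sum_sparse_le (s : R) : 1 <= s -> s ^+ 2 = ln N ->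
  \sum_(Z : mat) expR (- (2 * s ^+ 2 * light_weight (N / s) Z + 311 * s * lnq * weight R Z))
    <= 3.
Proof.
move=> s1 s2.
have N0 : 0 < N by rewrite ltr0n (ltn_trans _ n_gt3).
have lq0 := lnq_ge0.
pose a := 2 * s ^+ 2 + 10 * lnq.
pose phi (I J : {set 'I_n}) i j (z : 'Z_q) :=
  expR (- (a * [&& i \notin I, j \notin J & z != 0]%:R)).
(* Each heavy line pays q ^ (- 4 n): a factor q ^ n goes to filling the line, and the remaining [b]
   outweighs the 2 ^ n choices of the set. *)
pose cost (I : {set 'I_n}) := expR (- (4 * N * lnq * #|I|%:R)).
have le_phi Z : expR (- (2 * s ^+ 2 * light_weight (N / s) Z + 311 * s * lnq * weight R Z))
    <= \sum_I \sum_J cost I * cost J * \prod_i \prod_j phi I J i j (Z i j).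
  set I := heavy_rows (N / s) Z; set J := heavy_cols (N / s) Z.
  rewrite (bigD1 I) //= (bigD1 J) //= -addrA -[leLHS]addr0 lerD //; last first.
    have phi_ge0 I' J' : 0 <= cost I' * cost J' * \prod_i \prod_j phi I' J' i j (Z i j).
      rewrite mulr_ge0 ?mulr_ge0 ?expR_ge0 //.
      by do 2!(apply: prodr_ge0 => ? _); rewrite expR_ge0.
    by rewrite addr_ge0 //; do ?(apply: sumr_ge0 => ? _).
  have -> : \prod_i \prod_j phi I J i j (Z i j) = expR (- (a * light_weight (N / s) Z)).
    rewrite mulr_sumr -sumrN expR_sum; apply: eq_bigr => i _.
    by rewrite mulr_sumr -sumrN expR_sum; apply: eq_bigr.
  rewrite -!expRD ler_expR /a.
  have hI : N * #|I|%:R <= s * weight R Z.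
    have := heavy_rows_le (N / s) Z; rewrite mulrAC ler_pdivrMr; last lra.
    by rewrite [weight _ _ * _]mulrC.
  have hJ : N * #|J|%:R <= s * weight R Z.
    have := heavy_cols_le (N / s) Z; rewrite mulrAC ler_pdivrMr; last lra.
    by rewrite [weight _ _ * _]mulrC.
  have hl : light_weight (N / s) Z <= s * weight R Z.
    apply: le_trans (light_weight_le (N / s) Z) _.
    by rewrite ler_peMl // (le_trans _ (light_weight_le (N / s) Z)) ?light_weight_ge0.
  move: (ler_wpM2l lq0 hI) (ler_wpM2l lq0 hJ) (ler_wpM2l lq0 hl).
  have := mulr_ge0 lq0 (le_trans (light_weight_ge0 (N / s) Z) hl).
  lra.
apply: le_trans (ler_sum _ (fun Z _ => le_phi Z)) _.
rewrite exchange_big /=; under eq_bigr => I _ do rewrite exchange_big /=.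
pose b := expR (- (3 * N * lnq)).
apply: le_trans (_ : \sum_(I : {set 'I_n}) \sum_(J : {set 'I_n})
    expR 4^-1 * (b ^+ #|I| * b ^+ #|J|) <= _).
  apply: ler_sum => I _; apply: ler_sum => J _.
  rewrite -mulr_sumr sum_prod_mx.
  have : \prod_i \prod_j \sum_z phi I J i j z <=
      \prod_(i < n) \prod_(j < n) expR (lnq * (i \in I)%:R + lnq * (j \in J)%:R + (4 * N ^+ 2)^-1).
    apply: ler_prod => i _; apply/andP; split.
      by apply: prodr_ge0 => j _; apply: sumr_ge0 => z _; rewrite expR_ge0.
    apply: ler_prod => j _; apply/andP; split.
      by apply: sumr_ge0 => z _; rewrite expR_ge0.
    exact: sum_expR_entry_le.
  under [leRHS]eq_bigr => i _ do rewrite -expR_sum.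
  rewrite -expR_sum => le; apply: le_trans (ler_wpM2l _ le) _; first by rewrite mulr_ge0 ?expR_ge0.
  rewrite -!expRM_natr -!expRD ler_expR.
  have -> : \sum_(i < n) \sum_(j < n)
     (lnq * (i \in I)%:R + lnq * (j \in J)%:R + (4 * N ^+ 2)^-1) =
     lnq * (N * #|I|%:R) + lnq * (N * #|J|%:R) + 4^-1.
    under eq_bigr => i _ do rewrite !big_split /= !sumr_const card_ord -mulr_sumr.
    rewrite !big_split /= !sumr_const card_ord.
    have cardE (K : {set 'I_n}) : \sum_(i < n) (i \in K)%:R = #|K|%:R :> R.
      by rewrite -natr_card_sum; congr (_%:R); apply: eq_card => i; rewrite inE.
    rewrite cardE sumrMnl -mulr_sumr cardE -!mulrnA -[_ *+ n]mulr_natr -[_ *+ n]mulr_natr.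
    rewrite -[_ *+ (n * n)]mulr_natr natrM; field; lra.
  by lra.
under eq_bigr => I _ do rewrite -mulr_sumr -mulr_sumr.
rewrite -mulr_sumr -mulr_suml -expr2.
have b1 : 2 ^+ n * b <= 4^-1.
  have -> : b = (q%:R ^+ (3 * n))^-1 by rewrite /b -natrM expR_muln_lnq.
  have q2 : 2 <= q%:R :> R by rewrite ler_nat.
  apply: le_trans (_ : 2 ^+ n * (2 ^+ (3 * n))^-1 <= _).
    rewrite ler_wpM2l ?exprn_ge0 // lef_pV2 ?posrE ?exprn_gt0 //; last lra.
    by rewrite lerXn2r ?nnegrE //; lra.
  rewrite (_ : 3 * n = n + 2 * n)%N; last by rewrite mulSn.
  rewrite exprD invfM mulrA mulfV ?expf_neq0 ?mul1r ?pnatr_eq0 //.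
  rewrite lef_pV2 ?posrE ?exprn_gt0 //.
  apply: le_trans (_ : 2 ^+ 2 <= _); first lra.
  by rewrite ler_weXn2l ?ler1n // leq_pmulr // (ltn_trans _ n_gt3).
have b01 : 0 <= b <= 1.
  by rewrite expR_ge0 expR_le1 oppr_le0 !mulr_ge0.
have le54 := le_trans (sum_exp_card_le n b01) (lerD (lexx 1) b1).
have e43 : expR 4^-1 <= 4 / 3 :> R.
  rewrite -[4^-1]opprK expRN -[4 / 3]invrK lef_pV2 ?posrE ?expR_gt0 ?invr_gt0 ?divr_gt0 //.
  by apply: le_trans (expR_ge1Dx _); lra.
apply: le_trans (_ : 4 / 3 * (1 + 4^-1) ^+ 2 <= _); last lra.
rewrite ler_pM ?expR_ge0 ?sqr_ge0 // lerXn2r ?nnegrE //; last lra.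
by apply: sumr_ge0 => I _; rewrite exprn_ge0 // expR_ge0.
Qed.

End SparseSum.

(** * Upper bound *)

Lemma ln2_ge (R : realType) : 2 / 3 <= ln (2 : R).
Proof.
rewrite -ler_expR lnK ?posrE //.
(* Obtained by inverting exp (- 1 / 24) >= 23 / 24; the 16th power of 24 / 23 is still below 2. *)
have e : expR 24^-1 <= 24 / 23 :> R.
  rewrite -[24^-1]opprK expRN -[24 / 23]invrK lef_pV2 ?posrE ?expR_gt0 ?invr_gt0 ?divr_gt0 //.
  by apply: le_trans (expR_ge1Dx _); lra.
have -> : 2 / 3 = 16%:R * 24^-1 :> R by lra.
rewrite expRM_natl; apply: le_trans (_ : (24 / 23) ^+ 16 <= _); last lra.
by rewrite lerXn2r ?nnegrE ?expR_ge0 //; lra.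
Qed.

(** Here [lq] is log q, [K] is c log log (16 n), [g] is [gap], [lam] is the eigenvalue, and [Q],
    [k], [l] are [nquads], [weight], [light_weight] of the sparse representative. The cases
    [lam <= 0] and [N ^ 2 <= s * k] give the term with 200, the remaining case the last term. *)
Lemma eigval_pow_le (R : realType) (N s lq K c g lam Q k l : R) (t : nat) :
  4 <= N -> 1 <= s -> 0 <= lq -> 2 / 3 <= lq -> 640 <= K -> c <= 3 / 4 * K ->
  0 < g -> g <= 2 -> N ^+ 2 * (s ^+ 2 / 4 + K * s * lq) <= t%:R * g ->
  - 2^-1 <= lam -> g * Q <= N ^+ 4 * (1 - lam) -> N ^+ 2 * k <= Q ->
  4 * l * (N ^+ 2 - 2 * N * (N / s) - k) <= Q -> 1 <= k -> 0 <= l -> l <= k ->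
  lam ^+ (2 * t) <= expR (- (2 * c * lq)) *
    (2 * expR (- (200 * N ^+ 2 * lq)) + expR (- (2 * s ^+ 2 * l + 311 * s * lq * k))).
Proof.
move=> N4 s1 lq0 lq1 K640 cK g0 g2 ht lam1 hQ hk hl k1 l0 lk.
have M16 : 16 <= N ^+ 2 by rewrite (_ : 16 = 4 ^+ 2); [rewrite lerXn2r ?nnegrE //|]; lra.
set M := N ^+ 2 in M16 ht hk hl *.
have K0 : 0 <= K by lra.
have M0 : 0 < M by lra.
have M_ge0 := ltW M0.
have M_neq0 : M != 0 by rewrite gt_eqF.
have NM : N * (N / s) = M / s by rewrite mulrA -expr2.
set e1 := expR (- (200 * M * lq)); set e2 := expR (- (_ + _)).
have e1_ge0 : 0 <= e1 := expR_ge0 _; have e2_ge0 : 0 <= e2 := expR_ge0 _.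
have E_ge0 : 0 <= expR (- (2 * c * lq)) := expR_ge0 _.
have use1 x : x <= expR (- (2 * c * lq)) * e1 ->
    x <= expR (- (2 * c * lq)) * (2 * e1 + e2).
  by move/le_trans; apply; rewrite ler_wpM2l //; lra.
have slq : lq <= s * lq by rewrite ler_peMl.
(* For [lam <= 0], lam ^ 2 <= 1 / 4 <= 1 / e, and [t] is at least of order N ^ 2 K lq since
   [g <= 2]. *)
have [lam0|lam0] := leP lam 0.
  apply: use1; rewrite -expRD exprM.
  have lam2 : lam ^+ 2 <= expR (- 1).
    apply: le_trans (_ : 2^-1 ^+ 2 <= _).
      by rewrite -(sqrrN lam) lerXn2r ?nnegrE //; lra.
    rewrite (_ : - 1 = 2%:R * - 2^-1 :> R); last lra.
    rewrite expRM_natl lerXn2r ?nnegrE ?expR_ge0 ?invr_ge0 //.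
    by apply: le_trans (expR_ge1Dx _); lra.
  apply: le_trans (_ : expR (- 1) ^+ t <= _).
    by rewrite lerXn2r ?nnegrE ?expR_ge0 ?sqr_ge0.
  rewrite -expRM_natl ler_expR.
  have t0 : 0 <= t%:R :> R by [].
  have h1 : t%:R * g <= t%:R * 2 by rewrite ler_wpM2l.
  have h2 : M * (K * lq) <= M * (s ^+ 2 / 4 + K * s * lq).
    rewrite ler_wpM2l ?(ltW M0) // -mulrA; have := ler_wpM2l K0 slq.
    have := sqr_ge0 s; lra.
  have h3 : 0 <= M * ((K - 640) * lq) by rewrite mulr_ge0 // mulr_ge0 // subr_ge0.
  have h4 : 0 <= (M - 16) * (K * lq) by rewrite !mulr_ge0 ?subr_ge0.
  have h5 : 0 <= (3 / 4 * K - c) * lq by rewrite mulr_ge0 ?subr_ge0.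
  lra.
have QM : M ^+ 2 * (1 - lam) = N ^+ 4 * (1 - lam) by rewrite /M -exprM.
pose QQ := Q / M.
have QE : Q = QQ * M by rewrite /QQ mulfVK.
have QQk : k <= QQ by rewrite ler_pdivlMr // mulrC.
have main : 2 * (s ^+ 2 / 4 + K * s * lq) * QQ <= 2 * t%:R * (1 - lam).
  have QQ0 : 0 <= QQ by lra.
  have h1 : g * QQ <= M * (1 - lam).
    by rewrite -(ler_pM2r M0) -mulrA -QE mulrAC -expr2 QM.
  have h2 := ler_wpM2r QQ0 ht.
  have t0 : 0 <= t%:R :> R by [].
  have h3 := ler_wpM2l t0 h1.
  by rewrite -(ler_pM2l M0); lra.
have lam_exp : lam ^+ (2 * t) <= expR (- (2 * t%:R * (1 - lam))).
  have le : lam <= expR (lam - 1) by apply: le_trans (expR_ge1Dx _); lra.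
  apply: le_trans (_ : expR (lam - 1) ^+ (2 * t) <= _).
    by rewrite lerXn2r ?nnegrE ?expR_ge0 // ltW.
  by rewrite -expRM_natl natrM ler_expR; lra.
have sk0 : 0 <= s * k by rewrite mulr_ge0 //; lra.
have sk1 : 1 <= s * k by rewrite -[1]mulr1 ler_pM.
have c_le : c * lq <= 3 / 4 * (K * lq) by rewrite mulrA ler_wpM2r.
have Klq0 : 0 <= K * lq by rewrite mulr_ge0.
(* Three quarters of the left factor K s k lq give q ^ (- 2 c), by [c <= 3 / 4 * K] and
   [1 <= s * k]; the last quarter gives 320 by [640 <= K]. *)
have Kk : 2 * c * lq + 320 * (s * k * lq) <= 2 * (K * s * lq) * k.
  have h1 : 0 <= (K - 640) * (s * k * lq) by rewrite mulr_ge0 ?subr_ge0 // mulr_ge0.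
  have h2 : 0 <= (s * k - 1) * (K * lq) by rewrite mulr_ge0 ?subr_ge0.
  lra.
have KQ : 2 * (K * s * lq) * k <= 2 * (K * s * lq) * QQ.
  by rewrite ler_wpM2l // !mulr_ge0 //; lra.
have s2QQ : 0 <= s ^+ 2 * QQ by rewrite mulr_ge0 ?sqr_ge0 //; lra.
have [skM|skM] := leP M (s * k).
  apply: use1; rewrite -expRD; apply: le_trans lam_exp _; rewrite ler_expR.
  have := ler_wpM2r lq0 skM; have := mulr_ge0 (ltW M0) lq0; lra.
apply: le_trans lam_exp _; rewrite [leRHS]mulrDr -[leLHS]add0r lerD //.
  by rewrite !mulr_ge0.
rewrite -expRD ler_expR.
have hl' : 4 * l * (1 - 2 / s - k / M) <= QQ.
  rewrite ler_pdivlMr //; apply: le_trans hl; rewrite -mulrA.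
  rewrite -[2 * N * _]mulrA NM le_eqVlt; apply/orP; left; apply/eqP; field.
  by rewrite M_neq0 /=; lra.
(* The corrections 2 / s and k / M cost 8 s l and at most 4 s l before halving, the latter because s
   k < M. *)
have h6 : 2 * s ^+ 2 * l - 6 * (s * k) <= s ^+ 2 / 2 * QQ.
  have h1 := ler_wpM2l (sqr_ge0 s) hl'.
  have e : s ^+ 2 * (4 * l * (1 - 2 / s - k / M)) =
      4 * (s ^+ 2 * l) - 8 * (s * l) - 4 * (s * l) * (s * k / M).
    by field; rewrite M_neq0 /=; lra.
  have skM1 : s * k / M <= 1 by rewrite ler_pdivrMr // mul1r ltW.
  have sl0 : 0 <= s * l by rewrite mulr_ge0 //; lra.
  have h2 := ler_wpM2l sl0 skM1.
  have h3 : s * l <= s * k by rewrite ler_wpM2l //; lra.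
  by rewrite e in h1; lra.
(* As lq >= 2 / 3, the error 6 s k is at most 9 s k lq, and 320 - 9 = 311. *)
have h7 : 0 <= s * k * (lq - 2 / 3) by rewrite mulr_ge0 ?subr_ge0.
lra.
Qed.

Section UpperBound.
Variables (R : realType) (n q : nat).
Hypothesis n_gt3 : (3 < n)%N.
Hypothesis q_gt1 : (1 < q)%N.
Local Notation mat := 'M['Z_q]_n.
Local Notation N := (n%:R : R).
Local Notation lnq := (ln (q%:R : R)).

(** The injection [h] to sparse representatives allows the sum to be extended to all matrices. *)
Lemma sum_eigval_pow_le (i0 : 'I_n) (s K c : R) (t : nat) :
  1 <= s -> s ^+ 2 = ln N -> 640 <= K -> c <= 3 / 4 * K ->
  N ^+ 2 * (s ^+ 2 / 4 + K * s * lnq) <= t%:R * gap R q ->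
  \sum_(Y in freqs q i0 | Y != 0) eigval R Y ^+ (2 * t) <= 4 * expR (- (2 * c * lnq)).
Proof.
move=> s1 s2 K640 cK ht.
have n_gt1 : (1 < n)%N by apply: ltn_trans n_gt3.
have N4 : 4 <= N by rewrite ler_nat.
have q2 : 2 <= q%:R :> R by rewrite ler_nat.
have lnq23 : 2 / 3 <= lnq.
  by apply: le_trans (ln2_ge R) _; rewrite ler_ln ?posrE //; lra.
pose e1 := expR (- (200 * N ^+ 2 * lnq)).
pose F (Z : mat) := expR (- (2 * c * lnq)) * (2 * e1 +
  expR (- (2 * s ^+ 2 * light_weight (N / s) Z + 311 * s * lnq * weight R Z))).
pose h (Y : mat) : mat := rebase Y (sparse_base R (i0, i0) Y).
have h_inj : {in [pred Y in freqs q i0 | Y != 0] &, injective h}.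
  move=> Y Y' /andP[YW _] /andP[YW' _] hE; apply/matrixP => i j.
  rewrite (rebase_freqs (sparse_base R (i0, i0) Y) _ _ YW) -/(h Y) hE.
  by rewrite (rebase_freqs (sparse_base R (i0, i0) Y') _ _ YW').
have F_ge0 Z : 0 <= F Z.
  by rewrite mulr_ge0 ?expR_ge0 // addr_ge0 ?mulr_ge0 ?expR_ge0.
apply: le_trans (_ : \sum_(Y in freqs q i0 | Y != 0) F (h Y) <= _).
  apply: ler_sum => Y /andP[YW Y0].
  have hY0 : h Y != 0.
    apply: contra Y0 => /eqP hY; apply/eqP/matrixP => i j.
    by rewrite (rebase_freqs (sparse_base R (i0, i0) Y) _ _ YW) -/(h Y) hY quad0 mxE.
  apply: (eigval_pow_le (N := N) (g := gap R q) (Q := nquads R Y) N4 s1 _ lnq23 K640 cK) => //.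
  - by lra.
  - exact: gap_gt0.
  - exact: gap_le2.
  - apply: le_trans (eigval_ge R n_gt1 q_gt1 Y); rewrite lerN2 lef_pV2 ?posrE //; lra.
  - exact: gap_nquads_le.
  - exact: weight_sparse_le.
  - by have := nquads_light (N / s) (h Y); rewrite nquads_rebase.
  - exact: weight_ge1.
  - exact: light_weight_ge0.
  - exact: light_weight_le.
apply: le_trans (_ : \sum_Z F Z <= _).
  rewrite (eq_bigl [in [set Y in freqs q i0 | Y != 0]]) => [|Y]; last by rewrite !inE.
  rewrite -(big_imset F) /= => [|Y Y']; last first.
    by rewrite !inE => YD Y'D; apply: h_inj; rewrite !inE.
  by rewrite [leLHS]big_mkcond; apply: ler_sum => Z _; case: ifP.
rewrite -mulr_sumr mulrC ler_wpM2r ?expR_ge0 // big_split /= sumr_const.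
have := sum_sparse_le n_gt3 q_gt1 s1 s2.
(* The dense term, q ^ (- 200 n ^ 2), beats the number q ^ (n ^ 2) of matrices; with [sum_sparse_le]
   the total is 1 + 3. *)
suff : 2 * e1 *+ #|{: mat}| <= 1 by lra.
rewrite card_mx (card_Zq q_gt1) -mulr_natl natrX.
have -> : e1 = (q%:R ^+ (200 * (n * n)))^-1.
  by rewrite -(expR_muln_lnq R q_gt1) !natrM.
have -> : (200 * (n * n) = n * n + (199 * (n * n)))%N by rewrite -mulSn.
have q_neq0 : q%:R != 0 :> R by rewrite gt_eqF //; lra.
rewrite exprD invfM mulrCA mulVKf ?expf_neq0 //.
rewrite ler_pdivrMr ?exprn_gt0 ?mul1r //; last lra.
rewrite -[leLHS]expr1; apply: le_trans (_ : 2 ^+ (199 * (n * n)) <= _).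
  by rewrite ler_weXn2l ?ler1n // !muln_gt0 /= !(ltn_trans _ n_gt3).
by rewrite lerXn2r ?nnegrE //; lra.
Qed.

Lemma max_tv_upper (r s : 'I_n -> 'Z_q) (c : R) (t : nat) :
  640 / ln (ln (16 * N)) <= c ->
  N ^+ 2 / (4 * gap R q) * ln N
    + N ^+ 2 / gap R q * c * ln (ln (16 * N)) * Num.sqrt (ln N) * lnq <= t%:R ->
  max_tv R r s t <= q%:R `^ (- c).
Proof.
set L := ln (ln _) => cL ht.
have n_gt1 : (1 < n)%N by apply: ltn_trans n_gt3.
have N4 : 4 <= N by rewrite ler_nat.
have ln2 := ln2_ge R.
have ln4 : 4 / 3 <= ln 4 :> R.
  by rewrite (_ : 4 = 2 ^+ 2) ?lnXn //; lra.
have lnN : 4 / 3 <= ln N by apply: le_trans ln4 _; rewrite ler_ln ?posrE //; lra.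
have ln64 : 4 <= ln 64 :> R.
  by rewrite (_ : 64 = 2 ^+ 6) ?lnXn //; lra.
have ln16N : 4 <= ln (16 * N).
  by apply: le_trans ln64 _; rewrite ler_ln ?posrE //; lra.
have L43 : 4 / 3 <= L.
  by apply: le_trans ln4 _; rewrite ler_ln ?posrE //; lra.
have g0 := gap_gt0 R q_gt1.
have K640 : 640 <= c * L by rewrite -ler_pdivrMr //; lra.
have c0 : 0 <= c by apply: le_trans cL; rewrite divr_ge0 //; lra.
have s2 : Num.sqrt (ln N) ^+ 2 = ln N by rewrite sqr_sqrtr //; lra.
have s1 : 1 <= Num.sqrt (ln N).
  rewrite -[leLHS](@sqrtr1 R) ler_wsqrtr //; lra.
have ht' : N ^+ 2 * (Num.sqrt (ln N) ^+ 2 / 4 + c * L * Num.sqrt (ln N) * lnq)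
    <= t%:R * gap R q.
  rewrite s2 -ler_pdivrMr //; apply: le_trans ht.
  by rewrite le_eqVlt; apply/orP; left; apply/eqP; field; rewrite gt_eqF.
have cK : c <= 3 / 4 * (c * L) by have := ler_wpM2l c0 L43; lra.
(* The default value 0 of the maximum also has to lie below the bound. *)
apply: bigmax_le; first exact: powR_ge0.
move=> A AO; have i0 : 'I_n by exists 0%N; apply: ltnW.
have := sqr_tv_dist_le R n_gt1 q_gt1 i0 t AO.
move/le_trans => /(_ _ (sum_eigval_pow_le i0 s1 s2 K640 cK ht')).
have -> : 4 * expR (- (2 * c * lnq)) = (2 * q%:R `^ (- c)) ^+ 2.
  rewrite /powR ifF; last by rewrite pnatr_eq0 gtn_eqF // ltnW.
  by rewrite exprMn -expRM_natl; congr (_ * expR _); lra.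
rewrite ler_pXn2r ?nnegrE ?mulr_ge0 ?powR_ge0 ?invr_ge0 //; last first.
  by apply: sumr_ge0 => B _; rewrite normr_ge0.
by rewrite ler_pM2l.
Qed.

End UpperBound.

(** * Lower bound *)

Section CellFrequencies.
Variables (R : realType) (n q : nat).
Hypothesis n_gt3 : (3 < n)%N.
Hypothesis q_gt1 : (1 < q)%N.
Local Notation mat := 'M['Z_q]_n.
Local Notation C := (cosq R).
Local Notation N := (n%:R : R).
Let n_gt1 : (1 < n)%N := ltn_trans (isT : (1 < 3)%N) n_gt3.

Definition splits (a i i' : 'I_n) : R := ((i == a) != (i' == a))%:R.

Lemma splitsE (a i i' : 'I_n) :
  splits a i i' = (i == a)%:R + (i' == a)%:R - 2 * ((i == a)%:R * (i' == a)%:R).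
Proof. by rewrite /splits; case: (i == a); case: (i' == a) => /=; lra. Qed.

Lemma sum_eq_const (a : 'I_n) : \sum_i (i == a)%:R = 1 :> R.
Proof. by rewrite (bigD1 a) //= eqxx big1 ?addr0 // => i /negPf ->. Qed.

Lemma sum_splits (a : 'I_n) : \sum_i \sum_i' splits a i i' = 2 * (N - 1).
Proof.
under eq_bigr => i _ do (under eq_bigr do rewrite splitsE).
under eq_bigr => i _ do rewrite sumrB big_split /= -!mulr_sumr sum_eq_const sumr_const card_ord mulr1.
rewrite sumrB big_split /= sumrMnl -mulr_sumr sum_eq_const sumr_const card_ord; lra.
Qed.

Lemma sum_splits2 (a a' : 'I_n) :
  \sum_i \sum_i' splits a i i' * splits a' i i' = if a == a' then 2 * (N - 1) else 2.
Proof.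
case: eqVneq => [<-|aa'].
  rewrite -(sum_splits a); apply: eq_bigr => i _; apply: eq_bigr => i' _.
  by rewrite /splits; case: (_ != _); rewrite ?mulr1 ?mulr0.
transitivity (\sum_(i < n) \sum_(i' < n)
    ((i == a)%:R * (i' == a')%:R + (i == a')%:R * (i' == a)%:R : R)).
  apply: eq_bigr => i _; apply: eq_bigr => i' _; rewrite /splits.
  have excl k : ~~ ((k == a) && (k == a')).
    by apply: contra aa' => /andP[/eqP <- /eqP ->].
  move: (excl i) (excl i'); case: (i == a); case: (i' == a); case: (i == a');
    by case: (i' == a') => //= _ _; lra.
under eq_bigr => i _ do rewrite big_split /= -!mulr_sumr !sum_eq_const !mulr1.
by rewrite big_split /= !sum_eq_const; lra.
Qed.

Lemma sum4_mul (f g : 'I_n -> 'I_n -> R) :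
  \sum_i \sum_i' \sum_j \sum_j' f i i' * g j j' =
  (\sum_i \sum_i' f i i') * (\sum_j \sum_j' g j j').
Proof.
rewrite mulr_suml; apply: eq_bigr => i _; rewrite mulr_suml; apply: eq_bigr => i' _.
by rewrite mulr_sumr; apply: eq_bigr => j _; rewrite mulr_sumr.
Qed.

Definition cell (p : 'I_n * 'I_n) : mat := delta_mx p.1 p.2.

(** Indicator that a move on rows [i], [i'] and columns [j], [j'] changes the entry at [p]. *)
Definition hits (p : 'I_n * 'I_n) i i' j j' : R := splits p.1 i i' * splits p.2 j j'.

Lemma sum_hits p : \sum_i \sum_i' \sum_j \sum_j' hits p i i' j j' = 4 * (N - 1) ^+ 2.
Proof. by rewrite sum4_mul !sum_splits; ring. Qed.

Lemma sum_hits2 p p' :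
  \sum_i \sum_i' \sum_j \sum_j' hits p i i' j j' * hits p' i i' j j' =
  (if p.1 == p'.1 then 2 * (N - 1) else 2) * (if p.2 == p'.2 then 2 * (N - 1) else 2).
Proof.
rewrite -!sum_splits2 -sum4_mul; do 4!(apply: eq_bigr => ? _).
by rewrite /hits mulrACA.
Qed.

Lemma quad_cell p i i' j j' :
  [\/ quad (cell p) i i' j j' = 0 /\ hits p i i' j j' = 0,
      quad (cell p) i i' j j' = 1 /\ hits p i i' j j' = 1 |
      quad (cell p) i i' j j' = -1 /\ hits p i i' j j' = 1].
Proof.
have -> : quad (cell p) i i' j j' =
    ((i == p.1)%:R - (i' == p.1)%:R) * ((j == p.2)%:R - (j' == p.2)%:R).
  by rewrite /quad !mxE -!mulnb !natrM; ring.
rewrite /hits /splits; do 4!case: (_ == _) => /=;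
  rewrite ?(subrr, subr0, sub0r, mul0r, mulr0, mulr1, mul1r, mulN1r, mulrN1, opprK, oppr0);
  first [by apply: Or31 | by apply: Or32 | by apply: Or33].
Qed.

Lemma quadB (Y Y' : mat) i i' j j' :
  quad (Y - Y') i i' j j' = quad Y i i' j j' - quad Y' i i' j j'.
Proof. by rewrite /quad !mxE; ring. Qed.

Lemma cosq_quad_cell p i i' j j' :
  1 - C (quad (cell p) i i' j j') = gap R q * hits p i i' j j'.
Proof.
by have [[-> ->]|[-> ->]|[-> ->]] := quad_cell p i i' j j';
  rewrite ?cosqN // ?cosq0 ?subrr ?mulr0 ?mulr1 ?cosq1.
Qed.

(** The lower bound counts the moves that change exactly one of the two entries; when both change,
    it only says that a cosine is at most 1. *)
Lemma cosq_quad_cells p p' i i' j j' :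
  gap R q * (hits p i i' j j' + hits p' i i' j j' - 2 * (hits p i i' j j' * hits p' i i' j j'))
  <= 1 - C (quad (cell p - cell p') i i' j j') <=
  2 * (hits p i i' j j' + hits p' i i' j j').
Proof.
have g2 := gap_le2 R q; have g1 := cosq1 R q_gt1.
rewrite quadB; set u := quad _ _ _ _ _ - quad _ _ _ _ _; have := cosq_le1 R u; have := cosq_geN1 R u.
rewrite /u; have [[-> ->]|[-> ->]|[-> ->]] := quad_cell p i i' j j';
  have [[-> ->]|[-> ->]|[-> ->]] := quad_cell p' i i' j j';
  rewrite ?sub0r ?subr0 ?opprK ?cosqN // ?cosq0 => ? ?; apply/andP; split; lra.
Qed.

Lemma eigval_cell p : eigval R (cell p) = 1 - 4 * gap R q / N ^+ 2.
Proof.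
have N4 : 4 <= N by rewrite ler_nat.
have := eigval_gap R n_gt1 q_gt1 (cell p).
under eq_bigr => i _ do (under eq_bigr => i' _ do (under eq_bigr => j _ do
  (under eq_bigr => j' _ do rewrite cosq_quad_cell))).
under eq_bigr => i _ do (under eq_bigr => i' _ do (under eq_bigr => j _ do
  rewrite -mulr_sumr)).
under eq_bigr => i _ do (under eq_bigr => i' _ do rewrite -mulr_sumr).
under eq_bigr => i _ do rewrite -mulr_sumr.
rewrite -mulr_sumr sum_hits => E.
have N0 : N != 0 by rewrite gt_eqF //; lra.
have N1 : N - 1 != 0 by rewrite gt_eqF //; lra.
apply: (mulfI (expf_neq0 2 N0)); apply: (mulfI (expf_neq0 2 N1)).
have -> : (N - 1) ^+ 2 * (N ^+ 2 * eigval R (cell p)) = (N - 1) ^+ 2 * N ^+ 2 -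
  N ^+ 2 * (N - 1) ^+ 2 * (1 - eigval R (cell p)) by ring.
by rewrite E; field.
Qed.

(** Two entries are nearly independent: the correction is 1 / (n - 1) if they share just a row or
    just a column, and 1 / (n - 1) ^ 2 if they share neither. *)
Lemma eigval_cells_le p p' :
  eigval R (cell p - cell p') <= 1 - 8 * gap R q / N ^+ 2 * (1 -
    (if p.1 == p'.1 then N - 1 else 1) * (if p.2 == p'.2 then N - 1 else 1) / (N - 1) ^+ 2).
Proof.
have N4 : 4 <= N by rewrite ler_nat.
have E := eigval_gap R n_gt1 q_gt1 (cell p - cell p').
have h0 : gap R q * (8 * (N - 1) ^+ 2 -
    2 * ((if p.1 == p'.1 then 2 * (N - 1) else 2) * (if p.2 == p'.2 then 2 * (N - 1) else 2)))
    <= N ^+ 2 * (N - 1) ^+ 2 * (1 - eigval R (cell p - cell p')).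
  rewrite E -sum_hits2.
  have -> : 8 * (N - 1) ^+ 2 = 4 * (N - 1) ^+ 2 + 4 * (N - 1) ^+ 2 by lra.
  rewrite -{1}(sum_hits p) -(sum_hits p') mulr_sumr -big_split -sumrB mulr_sumr.
  apply: ler_sum => i _; rewrite mulr_sumr -big_split -sumrB mulr_sumr.
  apply: ler_sum => i' _; rewrite mulr_sumr -big_split -sumrB mulr_sumr.
  apply: ler_sum => j _; rewrite mulr_sumr -big_split -sumrB mulr_sumr.
  by apply: ler_sum => j' _; have /andP[] := cosq_quad_cells p p' i i' j j'.
have N0 : N != 0 by rewrite gt_eqF //; lra.
have N1 : N - 1 != 0 by rewrite gt_eqF //; lra.
have NN0 : 0 < N ^+ 2 * (N - 1) ^+ 2 by rewrite mulr_gt0 // exprn_gt0 //; lra.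
rewrite -subr_ge0 -(pmulr_rge0 _ NN0); move: h0; rewrite -subr_ge0.
congr (0 <= _); case: ifP => _; case: ifP => _; field; by rewrite N0 N1.
Qed.

(** [1 - eigval] is at most 16 / n ^ 2, hence at most 1 for n >= 4. Nonnegativity allows
    [eigval_cells_le] to be raised to the power t. *)
Lemma eigval_cells_ge0 p p' : 0 <= eigval R (cell p - cell p').
Proof.
have N4 : 4 <= N by rewrite ler_nat.
have E := eigval_gap R n_gt1 q_gt1 (cell p - cell p').
have h0 : N ^+ 2 * (N - 1) ^+ 2 * (1 - eigval R (cell p - cell p')) <= 2 * (8 * (N - 1) ^+ 2).
  rewrite E.
  have -> : 8 * (N - 1) ^+ 2 = 4 * (N - 1) ^+ 2 + 4 * (N - 1) ^+ 2 by lra.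
  rewrite -{1}(sum_hits p) -(sum_hits p') -big_split mulr_sumr.
  apply: ler_sum => i _; rewrite -big_split mulr_sumr.
  apply: ler_sum => i' _; rewrite -big_split mulr_sumr.
  apply: ler_sum => j _; rewrite -big_split mulr_sumr.
  by apply: ler_sum => j' _; have /andP[] := cosq_quad_cells p p' i i' j j'.
have NN0 : 0 < (N - 1) ^+ 2 by rewrite exprn_gt0 //; lra.
have h1 : N ^+ 2 * (1 - eigval R (cell p - cell p')) <= 16.
  by rewrite -(ler_pM2l NN0); lra.
have N16 : 4 * 4 <= N ^+ 2 by rewrite expr2 ler_pM.
rewrite leNgt; apply/negP => lt0.
have := ler_wpM2r (_ : 0 <= 1 - eigval R (cell p - cell p')) N16; lra.
Qed.

(** A row and a column avoiding both entries isolate the corner [p]. This makes distinct entries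
    uncorrelated under the uniform law. *)
Lemma cells_quad_neq0 p p' : p != p' -> exists i i' j j',
  quad (cell p - cell p') i i' j j' != 0.
Proof.
move=> pp'.
have avoid (a b : 'I_n) : exists k, (a != k) && (b != k).
  have : (0 < #|~: [set a; b]|)%N.
    rewrite cardsCs setCK card_ord subn_gt0 cards2.
    by apply: leq_ltn_trans (ltnW n_gt3); case: (a != b).
  case/card_gt0P => k; rewrite !inE negb_or ![k == _]eq_sym => ?; by exists k.
have [i' /andP[ai a'i]] := avoid p.1 p'.1.
have [j' /andP[bj b'j]] := avoid p.2 p'.2.
exists p.1, i', p.2, j'; rewrite quadB /quad !mxE !eqxx /=.
rewrite ![i' == _]eq_sym ![j' == _]eq_sym (negPf ai) (negPf a'i) (negPf bj) (negPf b'j).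
rewrite !andbF !subr0 /= addr0.
have -> : (p.1 == p'.1) && (p.2 == p'.2) = false.
  by apply/negbTE; apply: contra pp'; case: (p) (p') => [a b] [a' b'] /= /andP[/eqP-> /eqP->].
by rewrite ?subr0 ?addr0 ?oppr0 ?addr0 ?subr0 oner_eq0.
Qed.

End CellFrequencies.

(** * The second moment method *)

Lemma tv_dist_min (R : realType) (T : finType) (X : {set T}) (mu nu : T -> R) :
  \sum_(x in X) mu x = 1 -> \sum_(x in X) nu x = 1 ->
  tv_dist X mu nu = 1 - \sum_(x in X) Num.min (mu x) (nu x).
Proof.
move=> mu1 nu1; rewrite /tv_dist.
have -> : \sum_(x in X) `|mu x - nu x| =
    \sum_(x in X) (mu x + (nu x - 2 * Num.min (mu x) (nu x))).
  apply: eq_bigr => x _; case: (leP (mu x) (nu x)) => [le|lt].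
    by rewrite distrC ger0_norm ?subr_ge0 //; lra.
  by rewrite ger0_norm ?subr_ge0 1?ltW //; lra.
by rewrite big_split sumrB /= mu1 nu1 -mulr_sumr; lra.
Qed.

Section SecondMoment.
Variables (R : realType) (n q : nat).
Hypothesis n_gt3 : (3 < n)%N.
Hypothesis q_gt1 : (1 < q)%N.
Variables (r s : 'I_n -> 'Z_q).
Local Notation mat := 'M['Z_q]_n.
Local Notation C := (cosq R).
Local Notation S := (sinq R).
Local Notation N := (n%:R : R).
Local Notation Omega := (tables r s).
Let n_gt1 : (1 < n)%N := ltn_trans (isT : (1 < 3)%N) n_gt3.

Lemma card_pairs_ord : #|{: 'I_n * 'I_n}|%:R = N ^+ 2.
Proof. by rewrite card_prod !card_ord natrM expr2. Qed.

(* With [x = B - A] and [f B] the sum of all [exp (2 i pi x_c / q)], the vector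
   [(fc, fs)] is [f B] in real coordinates, and [m ^+ 2 <= 2 |f| ^+ 2 + 2 |f - m| ^+ 2]
   bounds the overlap of the law of the walk, of mean [m], and of the uniform law,
   of mean [0]. *)
Lemma overlap_le (A : mat) (t : nat) (m : R) : A \in Omega ->
  m = \sum_(p : 'I_n * 'I_n) eigval R (cell q p) ^+ t ->
  m ^+ 2 * (1 - tv_dist Omega (walk_prob R t A) (unif_prob R r s)) <=
  2 * N ^+ 2 + 2 * (\sum_p \sum_p' eigval R (cell q p - cell q p' : mat) ^+ t - m ^+ 2).
Proof.
move=> AO mE.
have cardO : #|Omega|%:R != 0 :> R.
  by rewrite pnatr_eq0 cards_eq0; apply/set0Pn; exists A.
have sum_unif (f : mat -> R) :
    \sum_(B in Omega) unif_prob R r s B * f B = #|Omega|%:R^-1 * \sum_(B in Omega) f B.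
  by rewrite mulr_sumr; apply: eq_bigr => B BO; rewrite /unif_prob BO mul1r.
have unif1 : \sum_(B in Omega) unif_prob R r s B = 1.
  under eq_bigr do rewrite -[unif_prob _ _ _ _]mulr1.
  by rewrite (sum_unif (fun=> 1)) sumr_const mulVf.
have walk1 : \sum_(B in Omega) walk_prob R t A B = 1.
  under eq_bigr do rewrite -[walk_prob _ _ _ _]mulr1.
  rewrite (sum_walk_tables t (fun=> 1) AO) -[RHS](sum_walk_prob R n_gt1 q_gt1 A t).
  by apply: eq_bigr => B _; rewrite mulr1.
rewrite (tv_dist_min walk1 unif1) opprB addrC subrK.
pose x (B : mat) p := mxdot (cell q p) B - mxdot (cell q p) A.
pose fc B := \sum_p C (x B p); pose fs B := \sum_p S (x B p).
have normE B : fc B ^+ 2 + fs B ^+ 2 = \sum_p \sum_p' C (x B p - x B p').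
  by rewrite sum_cosq_sub.
have xB B p p' : x B p - x B p' =
    mxdot (cell q p - cell q p') B - mxdot (cell q p - cell q p') A.
  by rewrite /x !mxdotDl !mxdotNl; ring.
have mean_walk : \sum_(B in Omega) walk_prob R t A B * fc B = m.
  rewrite (sum_walk_tables _ _ AO) mE; under eq_bigr do rewrite mulr_sumr.
  rewrite exchange_big /=; apply: eq_bigr => p _.
  by rewrite sum_walk_cosq // subrr cosq0 mulr1.
have norm_walk : \sum_(B in Omega) walk_prob R t A B * (fc B ^+ 2 + fs B ^+ 2) =
    \sum_p \sum_p' eigval R (cell q p - cell q p' : mat) ^+ t.
  rewrite (sum_walk_tables _ _ AO); under eq_bigr do rewrite normE mulr_sumr.
  rewrite exchange_big /=; apply: eq_bigr => p _.
  under eq_bigr do rewrite mulr_sumr.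
  rewrite exchange_big /=; apply: eq_bigr => p' _.
  under eq_bigr do rewrite xB.
  by rewrite sum_walk_cosq // subrr cosq0 mulr1.
have norm_unif : \sum_(B in Omega) unif_prob R r s B * (fc B ^+ 2 + fs B ^+ 2) = N ^+ 2.
  rewrite sum_unif; under eq_bigr do rewrite normE.
  rewrite exchange_big mulr_sumr /= -card_pairs_ord -[RHS]sumr_const; apply: eq_bigr => p _.
  rewrite exchange_big (bigD1 p) //= [X in _ * (_ + X)]big1 => [|p' pp'].
    under eq_bigr do rewrite subrr cosq0.
    by rewrite sumr_const addr0 mulVf.
  have [i [i' [j [j' Q]]]] : exists i i' j j', quad (cell q p - cell q p') i i' j j' != 0.
    by apply: cells_quad_neq0; rewrite // eq_sym.
  under eq_bigr do rewrite xB.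
  exact: sum_tables_cosq_eq0 Q.
(* The sum of 2 U |f| ^ 2 + 2 P |f - m| ^ 2, with the second square expanded. *)
have -> : 2 * N ^+ 2 + 2 * (\sum_p \sum_p' eigval R (cell q p - cell q p' : mat) ^+ t - m ^+ 2) =
    \sum_(B in Omega) (2 * (unif_prob R r s B * (fc B ^+ 2 + fs B ^+ 2)) +
     (2 * (walk_prob R t A B * (fc B ^+ 2 + fs B ^+ 2)) +
     ((- (4 * m)) * (walk_prob R t A B * fc B) + (2 * m ^+ 2) * walk_prob R t A B))).
  rewrite big_split big_split big_split /= -!mulr_sumr.
  by rewrite norm_unif norm_walk mean_walk walk1; lra.
rewrite mulr_sumr; apply: ler_sum => B BO.
have P0 := walk_prob_ge0 R A B t.
have U0 : 0 <= unif_prob R r s B by rewrite divr_ge0.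
set P := walk_prob _ _ _ _ in P0 *; set U := unif_prob _ _ _ _ in U0 *.
set c := fc B; set d := fs B; set mn := Num.min P U.
have mP : mn <= P by rewrite ge_min lexx.
have mU : mn <= U by rewrite ge_min lexx orbT.
have mn0 : 0 <= mn by rewrite le_min P0 U0.
have h1 : mn * (c ^+ 2 + d ^+ 2) <= U * (c ^+ 2 + d ^+ 2).
  by rewrite ler_wpM2r // addr_ge0 ?sqr_ge0.
have h2 : mn * ((c - m) ^+ 2 + d ^+ 2) <= P * ((c - m) ^+ 2 + d ^+ 2).
  by rewrite ler_wpM2r // addr_ge0 ?sqr_ge0.
(* This square is 2 |f| ^ 2 + 2 |f - m| ^ 2 - m ^ 2. *)
have h3 : 0 <= mn * ((2 * c - m) ^+ 2 + 4 * d ^+ 2).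
  by rewrite mulr_ge0 // addr_ge0 ?sqr_ge0 // mulr_ge0 ?sqr_ge0.
lra.
Qed.

(** [Us] bounds pairs of entries sharing a row or a column, [Ud] pairs sharing neither; the diagonal
    contributes N ^ 2. *)
Lemma sum_eigval_cells_le (t : nat) (Us Ud : R) :
  Us = expR (- (t%:R * (8 * gap R q / N ^+ 2 * (1 - (N - 1)^-1)))) ->
  Ud = expR (- (t%:R * (8 * gap R q / N ^+ 2 * (1 - (N - 1)^-2)))) ->
  \sum_p \sum_p' eigval R (cell q p - cell q p' : mat) ^+ t <=
  N ^+ 2 + (2 * N ^+ 3 * Us + N ^+ 4 * Ud).
Proof.
move=> UsE UdE.
have N4 : 4 <= N by rewrite ler_nat.
have N1 : N - 1 != 0 by rewrite gt_eqF //; lra.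
have Us0 : 0 <= Us by rewrite UsE expR_ge0.
have Ud0 : 0 <= Ud by rewrite UdE expR_ge0.
have bE : (N - 1) / (N - 1) ^+ 2 = (N - 1)^-1 by field.
have le p p' : eigval R (cell q p - cell q p' : mat) ^+ t <=
    (p == p')%:R + (Us * (p.1 == p'.1)%:R + Us * (p.2 == p'.2)%:R + Ud).
  have [<-|pp'] := eqVneq p p'.
    by rewrite subrr (eigval0 R n_gt1 q_gt1) expr1n !eqxx !mulr1 lerDl !addr_ge0.
  have := eigval_cells_le R n_gt3 q_gt1 p p'.
  set b := (if _ then _ else _) * _ / _ => le.
  have lexp : eigval R (cell q p - cell q p') ^+ t <=
      expR (- (t%:R * (8 * gap R q / N ^+ 2 * (1 - b)))).
    rewrite -mulrN expRM_natl lerXn2r ?nnegrE ?expR_ge0 ?eigval_cells_ge0 //.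
    by apply: le_trans le _; exact: expR_ge1Dx.
  apply: le_trans lexp _; rewrite /b add0r.
  have [p1|p1] := eqVneq p.1 p'.1; have [p2|p2] := eqVneq p.2 p'.2.
  - by case/eqP: pp'; case: (p) (p') p1 p2 => [? ?] [? ?] /= -> ->.
  - by rewrite mulr1 mulr0 addr0 bE -UsE mulr1 lerDl.
  - by rewrite mul1r mulr0 add0r bE -UsE mulr1 lerDl.
  - by rewrite !mulr0 mulr1 !add0r mul1r -UdE.
have sum_eq (k : 'I_n) : \sum_(i < n) (k == i)%:R = 1 :> R.
  by under eq_bigr do rewrite eq_sym; rewrite sum_eq_const.
have sum_row (p : 'I_n * 'I_n) : \sum_(p' : 'I_n * 'I_n) (p.1 == p'.1)%:R = N.
  rewrite -(pair_bigA _ (fun a b : 'I_n => (p.1 == a)%:R)) /= exchange_big /=.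
  by under eq_bigr do rewrite sum_eq; rewrite sumr_const card_ord.
have sum_col (p : 'I_n * 'I_n) : \sum_(p' : 'I_n * 'I_n) (p.2 == p'.2)%:R = N.
  rewrite -(pair_bigA _ (fun a b : 'I_n => (p.2 == b)%:R)) /=.
  by under eq_bigr do rewrite sum_eq; rewrite sumr_const card_ord.
have sum_cell (p : 'I_n * 'I_n) : \sum_p' (p == p')%:R = 1 :> R.
  by rewrite (bigD1 p) //= eqxx big1 ?addr0 // => p'; rewrite eq_sym => /negPf ->.
have -> : N ^+ 2 + (2 * N ^+ 3 * Us + N ^+ 4 * Ud) =
    \sum_(p : 'I_n * 'I_n) \sum_(p' : 'I_n * 'I_n) ((p == p')%:R + (Us * (p.1 == p'.1)%:R + Us * (p.2 == p'.2)%:R + Ud)).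
  under eq_bigr => p _ do rewrite !big_split /= -!mulr_sumr sum_cell sum_row sum_col
    sumr_const -[Ud *+ _]mulr_natr card_pairs_ord.
  by rewrite sumr_const -[RHS]mulr_natr card_pairs_ord; ring.
by apply: ler_sum => p _; apply: ler_sum => p' _.
Qed.

End SecondMoment.

(** * Numerical estimates for the lower bound *)

Lemma expR_le_aff (R : realType) (z : R) : 0 <= z <= 2^-1 -> expR z <= 1 + 2 * z.
Proof.
case/andP=> z0 z1; rewrite -[z in leLHS]opprK expRN -[leRHS]invrK.
rewrite lef_pV2 ?posrE ?expR_gt0 ?invr_gt0 //; last lra.
apply: le_trans (expR_ge1Dx _); rewrite -div1r ler_pdivrMr; last lra.
have : 0 <= z * (1 - 2 * z) by rewrite mulr_ge0 //; lra.
lra.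
Qed.

Lemma expR3_le64 (R : realType) : expR 3 <= 64 :> R.
Proof.
have -> : 3 = 6%:R * 2^-1 :> R by lra.
rewrite expRM_natl; apply: le_trans (_ : 2 ^+ 6 <= _); last lra.
rewrite lerXn2r ?nnegrE ?expR_ge0 //.
by have := @expR_le_aff R 2^-1; lra.
Qed.

Lemma expR_le_subr (R : realType) (x : R) : 0 <= x <= 2^-1 ->
  expR (- (x + 2 * x ^+ 2)) <= 1 - x.
Proof.
case/andP=> x0 x1; rewrite expRN -[leRHS]invrK lef_pV2 ?posrE ?expR_gt0 ?invr_gt0 //; last lra.
apply: le_trans (expR_ge1Dx _); rewrite -div1r ler_pdivrMr; last lra.
have : 0 <= x ^+ 2 * (1 - 2 * x) by rewrite mulr_ge0 ?sqr_ge0 //; lra.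
lra.
Qed.

(** With w = q ^ (- (c + 12)), the variance and the uniform term are at most a constant times w N ^
    4 rho. The constant is below 512, and q ^ 12 >= 512 absorbs it. *)
Lemma second_moment_numeric (R : realType) (N g lq c : R) (t : nat) :
  0 < N -> 0 < g -> g <= 2 -> 2 / 3 <= lq -> 512 <= expR (12 * lq) -> 0 <= c ->
  t%:R <= N ^+ 2 / (4 * g) * ln N - N ^+ 2 / (4 * g) * (c + 12) * lq ->
  let rho := (1 - 4 * g / N ^+ 2) ^+ (2 * t) in
  let Us := expR (- (t%:R * (8 * g / N ^+ 2 * (1 - (N - 1)^-1)))) in
  let Ud := expR (- (t%:R * (8 * g / N ^+ 2 * (1 - (N - 1)^-2)))) in
  0 < rho /\
  2 * N ^+ 2 + 2 * (N ^+ 2 + (2 * N ^+ 3 * Us + N ^+ 4 * Ud) - N ^+ 4 * rho) <=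
  N ^+ 4 * rho * expR (- (c * lq)).
Proof.
move=> N0 g0 g2 lq23 q12 c0 ht rho Us Ud.
have lq0 : 0 <= lq by clear -lq23; lra.
have N_neq0 : N != 0 by rewrite gt_eqF.
have g_neq0 : g != 0 by rewrite gt_eqF.
have t0 : 0 <= t%:R :> R by [].
pose v := N^-1; pose x := 4 * g * v ^+ 2; pose y := 2 * t%:R * x.
pose w := expR (- ((c + 12) * lq)).
have v0 : 0 < v by rewrite invr_gt0.
have vN : v * N = 1 by rewrite mulVf.
have x0 : 0 <= x by rewrite mulr_ge0 ?sqr_ge0 // mulr_ge0 // ltW.
have y0 : 0 <= y by rewrite mulr_ge0 // mulr_ge0.
have y_le : y <= 2 * (ln N - (c + 12) * lq).
  have -> : 2 * (ln N - (c + 12) * lq) = 2 *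
      (N ^+ 2 / (4 * g) * ln N - N ^+ 2 / (4 * g) * (c + 12) * lq) * x.
    by rewrite /x /v; field; rewrite N_neq0 g_neq0.
  by rewrite ler_wpM2r // ler_wpM2l.
have clq0 : 0 <= (c + 12) * lq by rewrite mulr_ge0 // addr_ge0.
have w0 : 0 < w by rewrite expR_gt0.
(* As [y] is nonnegative, the hypothesis on [t] forces N >= q ^ (c + 12). *)
have lnN : (c + 12) * lq <= ln N by clear -y0 y_le; lra.
have vw : v <= w.
  by rewrite /v /w expRN lef_pV2 ?posrE ?expR_gt0 // -[leRHS](@lnK R) ?posrE // ler_expR.
have w_le : w * 512 <= expR (- (c * lq)).
  have -> : expR (- (c * lq)) = w * expR (12 * lq) by rewrite -expRD; congr expR; ring.
  by rewrite ler_wpM2l ?expR_ge0.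
have d1 : expR (- (c * lq)) <= 1 by rewrite expR_le1 oppr_le0 mulr_ge0.
have y_exp : expR y <= N ^+ 2 * w ^+ 2.
  have -> : N ^+ 2 * w ^+ 2 = expR (2%:R * (ln N - (c + 12) * lq)).
    by rewrite expRM_natl expRD lnK ?posrE // exprMn.
  by rewrite ler_expR.
(* A crude bound on the logarithm suffices: below, [y] is multiplied by quantities of order 1 / N or
   smaller. *)
have y2N : y <= 2 * N.
  by have := ln_sublinear N0; clear -y_le clq0; lra.
have x_le : x <= 8 * v ^+ 2 by rewrite /x ler_wpM2r ?sqr_ge0 //; clear -g2; lra.
have rhoE : rho = (1 - x) ^+ (2 * t) by rewrite /rho /x /v exprVn.
have UsE : Us = expR (- (y * (1 - (N - 1)^-1))).
  by rewrite /Us /y /x /v; congr (expR (- _)); rewrite exprVn; ring.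
have UdE : Ud = expR (- (y * (1 - (N - 1)^-1 ^+ 2))).
  by rewrite /Ud /y /x /v; congr (expR (- _)); rewrite !exprVn; ring.
have yE : y = 2 * t%:R * x by [].
move: (expR (- (c * lq))) w_le d1 => d w_le d1.
clearbody w v x y Us Ud rho.
clear ht y_le lnN clq0 q12 c0 lq23 lq0 g0 g2 g_neq0 t0 lq g c.
have v1 : v <= 512^-1 by clear -vw w_le d1; lra.
have vv : v ^+ 2 <= v * 512^-1 by rewrite expr2 ler_wpM2l // ltW.
have x_half : x <= 2^-1 by clear -x_le vv v1; lra.
have rho_ge : expR (- (y * (1 + 2 * x))) <= rho.
  rewrite rhoE; apply: le_trans (_ : expR (- (x + 2 * x ^+ 2)) ^+ (2 * t) <= _).
    rewrite -expRM_natl ler_expR natrM yE le_eqVlt; apply/orP; left; apply/eqP.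
    by ring.
  rewrite lerXn2r ?nnegrE ?expR_ge0 ?expR_le_subr ?x0 //.
  by clear -x_half; lra.
have rho0 : 0 < rho by apply: lt_le_trans rho_ge; apply: expR_gt0.
(* Used with [z] equal to 1, [b] and [b ^+ 2], to compare 1, [Us] and [Ud] with [rho]. *)
have ratio z : expR (- (y * (1 - z))) <= rho * expR (y * (2 * x + z)).
  apply: le_trans (_ : expR (- (y * (1 + 2 * x))) * expR (y * (2 * x + z)) <= _).
    by rewrite -expRD ler_expR; clear; lra.
  by rewrite ler_wpM2r ?expR_ge0.
have N512 : 512 <= N.
  rewrite -(ler_pM2l v0) vN; clear -v1; lra.
pose b := (N - 1)^-1; rewrite -/b in UsE UdE.
have b0 : 0 < b by rewrite invr_gt0; clear -N512; lra.
have Nb : N * b = 1 + b.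
  by rewrite /b; field; rewrite gt_eqF //; clear -N512; lra.
have b1 : b <= 4^-1 by rewrite lef_pV2 ?posrE; clear -N512; lra.
have bv : b <= v + v / 4.
  have e : b = v + v * b by rewrite -[LHS]mul1r -vN -mulrA Nb; ring.
  by rewrite {1}e lerD2l ler_wpM2l // ltW.
clearbody b.
have yv z k : 0 <= z -> z <= k -> y * z <= 2 * N * k by move=> z0 zk; rewrite ler_pM.
have NE : N * v ^+ 2 = v by rewrite expr2 mulrA [N * v]mulrC vN mul1r.
have x20 : 0 <= 2 * x by rewrite mulr_ge0.
have x2_le : 2 * x <= 16 * v ^+ 2 by clear -x_le; lra.
have h_one : 1 <= rho * (2 * (N ^+ 2 * w ^+ 2)).
  have := ratio 1; rewrite subrr mulr0 oppr0 expR0 => /le_trans; apply.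
  rewrite (ler_pM2l rho0) mulrDr mulr1 addrC expRD [leRHS]mulrC.
  rewrite ler_pM ?expR_ge0 //.
  have yx : y * (2 * x) <= 2^-1.
    by have := yv _ _ x20 x2_le; clear -v1 NE; lra.
  have yx0 : 0 <= y * (2 * x) by rewrite mulr_ge0.
  have := @expR_le_aff R (y * (2 * x)); rewrite yx yx0 => /(_ isT).
  by clear -yx; lra.
have h_Us : Us <= 64 * rho.
  rewrite UsE; apply: le_trans (ratio b) _; rewrite mulrC (ler_pM2r rho0).
  apply: le_trans _ (expR3_le64 R); rewrite ler_expR.
  have := yv _ _ (addr_ge0 x20 (ltW b0)) (lerD x2_le (lexx b)).
  by clear -v1 NE Nb b1; lra.
have h_Ud : Ud <= (1 + 72 * v) * rho.
  rewrite UdE; apply: le_trans (ratio (b ^+ 2)) _; rewrite mulrC (ler_pM2r rho0).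
  have b2v : b ^+ 2 <= 2 * v ^+ 2.
    have := ler_pM (ltW b0) (ltW b0) bv bv; rewrite -expr2; have := sqr_ge0 v.
    by clear; lra.
  have yx : y * (2 * x + b ^+ 2) <= 36 * v.
    have := yv _ _ (addr_ge0 x20 (sqr_ge0 b)) (lerD x2_le b2v).
    by clear -NE; lra.
  have yx0 : 0 <= y * (2 * x + b ^+ 2) by rewrite mulr_ge0 // addr_ge0 ?sqr_ge0.
  have yx2 : y * (2 * x + b ^+ 2) <= 2^-1 by clear -yx v1; lra.
  have := @expR_le_aff R (y * (2 * x + b ^+ 2)); rewrite yx0 yx2 => /(_ isT).
  by clear -yx; lra.
split=> //.
have N4 : 0 <= N ^+ 4 by rewrite exprn_ge0 // ltW.
have k1 := ler_wpM2l (sqr_ge0 N) h_one.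
have k2 : N ^+ 3 * Us <= N ^+ 4 * rho * (64 * v).
  have -> : N ^+ 4 * rho * (64 * v) = N ^+ 3 * (64 * rho) * (v * N) by ring.
  by rewrite vN mulr1 ler_wpM2l // exprn_ge0 // ltW.
have k3 := ler_wpM2l N4 h_Ud.
have Z0 : 0 <= N ^+ 4 * rho by rewrite mulr_ge0 // ltW.
(* In units of N ^ 4 rho, the terms are 8 w ^ 2, 256 v and 144 v, at most 408 w in total. *)
have k4 : N ^+ 4 * rho * v <= N ^+ 4 * rho * w by rewrite ler_wpM2l.
have k5 : N ^+ 4 * rho * w ^+ 2 <= N ^+ 4 * rho * w.
  by rewrite ler_wpM2l // expr2 ler_piMr ?ltW //; clear -w_le d1; lra.
have k6 := ler_wpM2l Z0 w_le.
have k7 : 0 <= N ^+ 4 * rho * w by rewrite mulr_ge0 // ltW.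
by clear -k1 k2 k3 k4 k5 k6 k7; lra.
Qed.

Lemma max_tv_lower (R : realType) (n q : nat) (r s : 'I_n -> 'Z_q) (c : R) (t : nat) :
  (3 < n)%N -> (1 < q)%N -> \sum_i r i = \sum_j s j -> 0 <= c ->
  t%:R <= n%:R ^+ 2 / (4 * gap R q) * ln n%:R
          - n%:R ^+ 2 / (4 * gap R q) * (c + 12) * ln q%:R ->
  1 - q%:R `^ (- c) <= max_tv R r s t.
Proof.
move=> n_gt3 q_gt1 rs c0 ht.
have n_gt1 : (1 < n)%N by apply: ltn_trans n_gt3.
have [A AO] := set0Pn _ (tables_neq0 n_gt1 rs).
apply: le_trans (le_bigmax_cond _ _ AO).
have N0 : 0 < n%:R :> R by rewrite ltr0n ltnW.
have q2 : 2 <= q%:R :> R by rewrite ler_nat.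
have lnq23 : 2 / 3 <= ln q%:R :> R.
  by apply: le_trans (ln2_ge R) _; rewrite ler_ln ?posrE //; lra.
have q12 : 512 <= expR (12 * ln q%:R) :> R.
  rewrite expRM_natl (expR_lnq R q_gt1); apply: le_trans (_ : 2 ^+ 9 <= _); first by rewrite -natrX ler_nat.
  apply: le_trans (_ : 2 ^+ 12 <= _); first by rewrite ler_weXn2l ?ler1n.
  by rewrite lerXn2r ?nnegrE //; lra.
have [rho0 le] := second_moment_numeric N0 (gap_gt0 R q_gt1) (gap_le2 R q) lnq23 q12 c0 ht.
have powE : q%:R `^ (- c) = expR (- (c * ln q%:R)) :> R.
  by rewrite /powR ifF ?mulNr // pnatr_eq0 gtn_eqF // ltnW.
set rho := (1 - _) ^+ _ in rho0 le.
pose m : R := n%:R ^+ 2 * (1 - 4 * gap R q / n%:R ^+ 2) ^+ t.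
have mE : m = \sum_(p : 'I_n * 'I_n) eigval R (cell q p) ^+ t.
  under eq_bigr do rewrite eigval_cell //.
  by rewrite sumr_const -[RHS]mulr_natl card_pairs_ord.
have m2 : m ^+ 2 = n%:R ^+ 4 * rho.
  by rewrite /m /rho exprMn -!exprM mulnC.
have m0 : 0 < m ^+ 2 by rewrite m2 mulr_gt0 // exprn_gt0.
have := overlap_le n_gt3 q_gt1 AO mE.
have S_le := sum_eigval_cells_le n_gt3 q_gt1 (t := t) erefl erefl.
rewrite powE lerBlDr -lerBlDl => h.
rewrite -(ler_pM2l m0); apply: le_trans h _; rewrite m2; apply: le_trans le.
by rewrite lerD2l ler_pM2l // lerD2r; exact: S_le.
Qed.

Theorem theorem1p2 (R : realType) (n q : nat) (hn : (4 <= n)%N)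
    (hq : (2 <= q)%N) (r s : 'I_n -> 'Z_q)
    (hrs : \sum_(i < n) r i = \sum_(j < n) s j) :
  (forall c : R, 640 / ln (ln (16 * n%:R)) <= c ->
   forall t : nat,
     n%:R ^+ 2 / (4 * (1 - cos (2 * pi / q%:R))) * ln n%:R
     + n%:R ^+ 2 / (1 - cos (2 * pi / q%:R))
       * c * ln (ln (16 * n%:R)) * Num.sqrt (ln n%:R) * ln q%:R
       <= t%:R ->
     max_tv R r s t <= q%:R `^ (- c))
  /\
  (forall c : R, 0 <= c ->
   forall t : nat,
     t%:R <= n%:R ^+ 2 / (4 * (1 - cos (2 * pi / q%:R))) * ln n%:R
             - n%:R ^+ 2 / (4 * (1 - cos (2 * pi / q%:R)))
               * (c + 12) * ln q%:R ->
     1 - q%:R `^ (- c) <= max_tv R r s t).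
Proof.
by split=> c hc t ht; [apply: max_tv_upper | apply: max_tv_lower].
Qed.
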